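(* Let $\mathbf X,\mathbf Y$ be finite dimensional Hilbert spaces, $\varphi:\mathbf X\to\mathbb R$ and $\Phi:\mathbf X\to\mathbf Y$ twice continuously differentiable, $g:\mathbf Y\to\overline{\mathbb R}$ proper, lower semicontinuous and convex, and let $\Theta\subset\mathbf X$ be a polyhedral convex set. Let $(\bar x,\bar y)$ be a solution to the KKT system $0\in\nabla_xL(x,y)+N_\Theta(x)$, $y\in\partial g(\Phi(x))$, for which the second-order sufficient condition $$\langle\nabla^2_{xx}L(\bar x,\bar y)w,w\rangle+\mathrm d^2g(\Phi(\bar x),\bar y)(\nabla\Phi(\bar x)w)>0\quad\text{for all }w\in\mathcal D\setminus\{0\}$$ holds, where $\mathcal D:=K_\Theta(\bar x,-\nabla_xL(\bar x,\bar y))\cap\{w\in\mathbf X\mid\nabla\Phi(\bar x)w\in K_g(\Phi(\bar x),\bar y)\}$. Assume further that one of the following conditions holds: (a) $g$ is $\mathcal C^2$-decomposable at $\bar u:=\Phi(\bar x)$, with a representation $g(u)=g(\bar u)+\vartheta(\Xi(u))$ near $\bar u$ satisfying the nondegeneracy condition $\mathrm{par}\{\partial\vartheta(\Xi(\bar u))\}\cap\ker\nabla\Xi(\bar u)^*=\{0\}$; (b) $g$ is twice epi-differentiable at $\Phi(\bar x)$ for $\bar y$ and $$\widehat D(\partial g)(\Phi(\bar x),\bar y)(w)=\mathrm{cl}\big(D(\partial g)(\Phi(\bar x),\bar y)(w)-K_g(\Phi(\bar x),\bar y)^*\big)\quad\text{for all }w\in\mathbf Y.$$ If the multiplier mapping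 $M_{\bar x,\psi}$ is calm at $(0,0)\in\mathbf X\times\mathbf Y$ for $\bar y$, then there exist constants $\gamma>0$ and $\kappa\ge0$ such that $$\|x-\bar x\|+\mathrm{dist}\big(y,M_{\bar x,\psi}(0,0)\big)\le\kappa\,r(x,y)\quad\text{for all }(x,y)\in\mathbb B_\gamma(\bar x,\bar y).$$
   Context: $\overline{\mathbb R}=[-\infty,\infty]$; $\mathbb B_r(x)$ is the closed ball of radius $r$ centered at $x$; $C^*$ is the polar cone of $C$; $\mathrm{par}\,C$ is the linear subspace parallel to the affine hull of $C$; $\mathrm{dist}(\cdot,\emptyset)=\infty$; $N_\Theta(x)$ is the normal cone, empty if $x\notin\Theta$ (so $r(x,y)=\infty$ when $x\notin\Theta$ and the estimate is then trivial). Lagrangian: $L(x,y)=\varphi(x)+\langle y,\Phi(x)\rangle$, associated with minimizing $\psi(x)=\varphi(x)+g(\Phi(x))$ over $x\in\Theta$. Residual: $r(x,y)=\mathrm{dist}(-\nabla_xL(x,y),N_\Theta(x))+\|\Phi(x)-\mathrm{prox}_g(\Phi(x)+y)\|$, with $\mathrm{prox}_g(y)=\mathrm{argmin}_z\{g(z)+\tfrac12\|y-z\|^2\}$. Multiplier mapping: $M_{\bar x,\psi}(v,w)=\{y\in\mathbf Y\mid v\in\nabla_xL(\bar x,y)+N_\Theta(\bar x),\ y\in\partial g(\Phi(\bar x)+w)\}$ for $(v,w)\in\mathbf X\times\mathbf Y$. A set-valued mapping $F$ is calm at $x$ for $y\in F(x)$ if there are neighborhoods $U$ of $x$, $V$ of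 $y$ and $\kappa>0$ with $F(x')\cap V\subset F(x)+\kappa\|x-x'\|\mathbb B$ for all $x'\in U$. Subderivative: $\mathrm df(\bar x)(w)=\liminf_{t\searrow0,\,w'\to w}\frac{f(\bar x+tw')-f(\bar x)}t$. Critical cone, for $\bar v\in\partial f(\bar x)$: $K_f(\bar x,\bar v)=\{w\mid\langle\bar v,w\rangle=\mathrm df(\bar x)(w)\}$; for a set, $K_\Theta(\bar x,\bar v)=K_{\delta_\Theta}(\bar x,\bar v)=T_\Theta(\bar x)\cap[\bar v]^\perp$ (with $T_\Theta$ the tangent cone and $\delta_\Theta$ the indicator function). Second-order difference quotient: $\Delta_t^2f(\bar x,\bar v)(w)=\frac{f(\bar x+tw)-f(\bar x)-t\langle\bar v,w\rangle}{\frac12t^2}$. Second subderivative: $\mathrm d^2f(\bar x,\bar v)(w)=\liminf_{t\searrow0,\,w'\to w}\Delta_t^2f(\bar x,\bar v)(w')$. $f$ is twice epi-differentiable at $\bar x$ for $\bar v$ if for all $w$ and all $t_k\searrow0$ there is $w^k\to w$ with $\Delta^2_{t_k}f(\bar x,\bar v)(w^k)\to\mathrm d^2f(\bar x,\bar v)(w)$. Graphical derivative: $\mathrm{gph}\,DF(\bar x,\bar y)=T_{\mathrm{gph}F}(\bar x,\bar y)$. Semi-strict graphical derivative: $\eta\in\widehat DF(\bar x,\bar y)(w)$ iff there exist $t_k\searrow0$, $(x^k,y^k)\to(\bar x,\bar y)$, $\hat y^k\to\bar y$ with $y^k\in F(x^k)$, $\hat y^k\in F(\bar x)$ and $\big(\frac{x^k-\bar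 x}{t_k},\frac{y^k-\hat y^k}{t_k}\big)\to(w,\eta)$. $\mathcal C^2$-decomposable: $g$ is $\mathcal C^2$-decomposable at $\bar u$ if $g(\bar u)$ is finite and $g(u)=g(\bar u)+\vartheta(\Xi(u))$ for $u$ in an open neighborhood $\mathcal O$ of $\bar u$, where $\vartheta:\mathbf Z\to\overline{\mathbb R}$ is proper, lsc and sublinear, $\Xi:\mathcal O\to\mathbf Z$ is $\mathcal C^2$-smooth with $\Xi(\bar u)=0$, and $\mathbf Z$ is a finite dimensional Hilbert space. *)

(* Defs.v *)
From HB Require Import structures.
From mathcomp Require Import all_boot all_order all_algebra.
From mathcomp Require Import all_classical all_reals all_analysis.

Set Implicit Arguments.
Unset Strict Implicit.
Unset Printing Implicit Defensive.
Import Order.TTheory GRing.Theory Num.Theory.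
Import numFieldNormedType.Exports.
Local Open Scope classical_set_scope.
Local Open Scope ring_scope.

(* Finite dimensional real Hilbert spaces: normed modules that are finite
   dimensional ([vectType]) and whose norm is induced by an inner product.
   Completeness is automatic in finite dimension. *)
HB.mixin Record NormedModule_hasInner (R : realType) V
    of NormedModule R V := {
  inner : V -> V -> R;
  innerC : forall x y, inner x y = inner y x;
  innerDl : forall x y z, inner (x + y) z = inner x z + inner y z;
  innerZl : forall a x y, inner (a *: x) y = a * inner x y;
  innerxx : forall x, inner x x = `|x| ^+ 2
}.

#[short(type="fdHilbertType")]
HB.structure Definition FDHilbert (R : realType) :=
  {V of NormedModule R V & Vector R V & NormedModule_hasInner R V}.

Section Topology.
Context {R : realType}.

(* The library norm on a product is the max norm; this is the Hilbert one. *)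
Definition l2norm {X Y : normedModType R} (p : X * Y) : R :=
  Num.sqrt (`|p.1| ^+ 2 + `|p.2| ^+ 2).

Definition dist {V : normedModType R} (x : V) (C : set V) : \bar R :=
  ereal_inf [set (`|x - z|)%:E | z in C].

Definition to_zero_pos (t : nat -> R) : Prop :=
  (forall k, 0 < t k) /\ t @ \oo --> 0.

Definition tangent_cone {V : normedModType R} (C : set V) (x : V) : set V :=
  [set w | exists (t : nat -> R) (w_ : nat -> V),
     [/\ to_zero_pos t, w_ @ \oo --> w & forall k, C (x + t k *: w_ k)]].

Definition gph {V W : Type} (F : V -> set W) : set (V * W) :=
  [set p | F p.1 p.2].

Definition graphical_derivative {V W : normedModType R} (F : V -> set W)
    (x : V) (y : W) (w : V) : set W :=
  [set eta | tangent_cone (gph F) (x, y) (w, eta)].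

Definition semistrict_derivative {V W : normedModType R} (F : V -> set W)
    (x : V) (y : W) (w : V) : set W :=
  [set eta | exists (t : nat -> R) (x_ : nat -> V) (y_ yh_ : nat -> W),
     [/\ to_zero_pos t,
         [/\ x_ @ \oo --> x, y_ @ \oo --> y & yh_ @ \oo --> y],
         forall k, F (x_ k) (y_ k) /\ F x (yh_ k),
         (fun k => (t k)^-1 *: (x_ k - x)) @ \oo --> w &
         (fun k => (t k)^-1 *: (y_ k - yh_ k)) @ \oo --> eta]].

(* Calmness of [F] at [x] for [y], with [N] the norm on the domain. *)
Definition calm {V W : normedModType R} (N : V -> R) (F : V -> set W)
    (x : V) (y : W) : Prop :=
  F x y /\
  exists (A : set V) (B : set W) (kappa : R),
    [/\ nbhs x A, nbhs y B, 0 < kappa &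
        forall x', A x' -> F x' `&` B `<=`
          [set z + (kappa * N (x - x')) *: b
             | z in F x & b in [set b : W | `|b| <= 1]]].

(* In finite dimension, continuity of [z |-> 'd f z] in operator norm amounts to
   continuity of [z |-> 'd f z h] for every fixed direction [h]; likewise for
   the second derivative. *)
Definition C1_on {V W : normedModType R} (O : set V) (f : V -> W) : Prop :=
  (forall x, O x -> differentiable f x) /\
  forall h x, O x -> {for x, continuous (fun z => 'd f z h)}.

Definition C2_on {V W : normedModType R} (O : set V) (f : V -> W) : Prop :=
  (forall x, O x -> differentiable f x) /\
  forall h, C1_on O (fun z => 'd f z h).

(* Affine subsets may be empty. *)
Definition affine_set {V : normedModType R} (A : set V) : Prop :=
  forall x y t, A x -> A y -> A ((1 - t) *: x + t *: y).

Definition aff {V : normedModType R} (C : set V) : set V :=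
  smallest affine_set C.

Definition par {V : normedModType R} (C : set V) : set V :=
  [set a - b | a in aff C & b in aff C].

Definition proper_efun {V : normedModType R} (f : V -> \bar R) : Prop :=
  (forall x, f x != -oo%E) /\ exists x, f x != +oo%E.

Definition convex_efun {V : normedModType R} (f : V -> \bar R) : Prop :=
  forall x y t, 0 < t < 1 ->
    (f (t *: x + (1 - t) *: y)%R <= t%:E * f x + (1 - t)%:E * f y)%E.

Definition sublinear {V : normedModType R} (f : V -> \bar R) : Prop :=
  [/\ (f 0%R < +oo)%E,
      forall a x, 0 < a -> f (a *: x) = (a%:E * f x)%E &
      forall x y, (f (x + y)%R <= f x + f y)%E].

Definition indicator {V : Type} (C : set V) (x : V) : \bar R :=
  if x \in C then 0%E else +oo%E.

Definition subderivative {V : normedModType R} (f : V -> \bar R) (x w : V) :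
    \bar R :=
  limf_einf (fun p : R * V =>
      ((f (x + p.1 *: p.2)%R - f x) * (p.1^-1)%:E)%E)
    (filter_prod (0 : R)^'+ (nbhs w)).

End Topology.

Section Hilbert.
Context {R : realType}.

(* Riesz representative of ['d f x], unique whenever [f] is differentiable. *)
Definition gradient {V : fdHilbertType R} (f : V -> R) (x : V) : V :=
  get [set v | forall h, 'd f x h = inner v h].

Definition hessian {V : fdHilbertType R} (f : V -> R) (x w : V) : V :=
  'd (gradient f) x w.

Definition adjoint {V W : fdHilbertType R} (f : V -> W) (z : W) : V :=
  get [set v | forall h, inner z (f h) = inner v h].

Definition polar_cone {V : fdHilbertType R} (C : set V) : set V :=
  [set v | forall w, C w -> inner v w <= 0].

Definition polyhedral {V : fdHilbertType R} (C : set V) : Prop :=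
  exists (m : nat) (a : 'I_m -> V) (b : 'I_m -> R),
    C = [set x | forall i, inner (a i) x <= b i].

(* Normal cone and subdifferential of convex analysis. *)
Definition normal_cone {V : fdHilbertType R} (C : set V) (x : V) : set V :=
  [set v | C x /\ forall z, C z -> inner v (z - x) <= 0].

Definition subdifferential {V : fdHilbertType R} (f : V -> \bar R) (x : V) :
    set V :=
  [set v | f x \is a fin_num /\
           forall z, (f x + (inner v (z - x)%R)%:E <= f z)%E].

Definition critical_cone {V : fdHilbertType R} (f : V -> \bar R) (x v : V) :
    set V :=
  [set w | (inner v w)%:E = subderivative f x w].

Definition diff_quotient2 {V : fdHilbertType R} (f : V -> \bar R) (x v : V)
    (t : R) (w : V) : \bar R :=
  ((f (x + t *: w)%R - f x - (t * inner v w)%:E) * ((2^-1 * t ^+ 2)^-1)%:E)%E.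

Definition second_subderivative {V : fdHilbertType R} (f : V -> \bar R)
    (x v w : V) : \bar R :=
  limf_einf (fun p : R * V => diff_quotient2 f x v p.1 p.2)
    (filter_prod (0 : R)^'+ (nbhs w)).

Definition twice_epi_differentiable {V : fdHilbertType R} (f : V -> \bar R)
    (x v : V) : Prop :=
  forall (w : V) (t : nat -> R), to_zero_pos t ->
  exists w_ : nat -> V, w_ @ \oo --> w /\
    (fun k => diff_quotient2 f x v (t k) (w_ k)) @ \oo -->
      second_subderivative f x v w.

Definition argmin {V : Type} (f : V -> \bar R) : set V :=
  [set z | forall z', (f z <= f z')%E].

(* The argmin is a singleton when [g] is proper, lsc and convex. *)
Definition prox {V : fdHilbertType R} (g : V -> \bar R) (y : V) : V :=
  get (argmin (fun z => g z + (2^-1 * `|y - z| ^+ 2)%:E)%E).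

(* The map [Xi] is only constrained on the open neighborhood [O] of [u]. *)
Definition C2_decomposition {Y Z : fdHilbertType R} (g : Y -> \bar R) (u : Y)
    (O : set Y) (theta : Z -> \bar R) (Xi : Y -> Z) : Prop :=
  [/\ g u \is a fin_num,
      open O /\ O u,
      [/\ proper_efun theta, lower_semicontinuous theta & sublinear theta],
      C2_on O Xi /\ Xi u = 0 &
      forall u', O u' -> g u' = (g u + theta (Xi u'))%E].

Definition nondegeneracy {Y Z : fdHilbertType R} (u : Y)
    (theta : Z -> \bar R) (Xi : Y -> Z) : Prop :=
  par (subdifferential theta (Xi u)) `&`
    [set z | adjoint ('d Xi u) z = 0] = [set 0].

Section Composite.
Context {X Y : fdHilbertType R}.
Variables (phi : X -> R) (Phi : X -> Y) (g : Y -> \bar R) (Theta : set X).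

Definition lagrangian (x : X) (y : Y) : R := phi x + inner y (Phi x).

Definition gradx_L (x : X) (y : Y) : X := gradient (lagrangian^~ y) x.

Definition hessx_L (x : X) (y : Y) (w : X) : X := hessian (lagrangian^~ y) x w.

Definition stationarity (x : X) (y : Y) : set X :=
  [set gradx_L x y + n | n in normal_cone Theta x].

Definition kkt_solution (x : X) (y : Y) : Prop :=
  stationarity x y 0 /\ subdifferential g (Phi x) y.

Definition residual (x : X) (y : Y) : \bar R :=
  (dist (- gradx_L x y)%R (normal_cone Theta x)
   + (`|Phi x - prox g (Phi x + y)|)%:E)%E.

Definition multiplier_map (x : X) (p : X * Y) : set Y :=
  [set y | stationarity x y p.1 /\ subdifferential g (Phi x + p.2) y].

Definition SOSC_cone (x : X) (y : Y) : set X :=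
  critical_cone (indicator Theta) x (- gradx_L x y) `&`
  [set w | critical_cone g (Phi x) y ('d Phi x w)].

Definition SOSC (x : X) (y : Y) : Prop :=
  forall w, SOSC_cone x y w -> w <> 0 ->
    (0 < (inner (hessx_L x y w) w)%:E
         + second_subderivative g (Phi x) y ('d Phi x w))%E.

End Composite.
End Hilbert.

(* Main.v *)
(* Let x(k), y(k) approach (xbar, ybar) with residuals o(t(k)), where
   t(k) = |x(k) - xbar|.  Replacing Phi(x) by prox_g(Phi(x) + y) turns (x, y)
   into a solution of a KKT system perturbed by O(r(x, y)); since Theta is
   polyhedral, N_Theta(x) is contained in N_Theta(xbar), so calmness of the
   multiplier mapping places multipliers yh(k) of xbar within O(t(k)) of y(k).
   Limits w of (x(k) - xbar) / t(k) and eta of (y(k) - yh(k)) / t(k) satisfy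
   w in D and eta in the semi-strict derivative of dg at Phi'(xbar) w, while
   monotonicity of N_Theta yields <Hess L w, w> + <eta, Phi'(xbar) w> <= 0.
   The second-order condition is contradicted once
   d^2 g(Phi'(xbar) w) <= <eta, Phi'(xbar) w>.

   Under (b) this inequality is obtained from recovery sequences along the
   step sizes lambda t(k) with lambda increasing to 1.  Under (a) write
   theta(z + n) = theta(z) + <lam, n> for n orthogonal to par C, where C is the
   subdifferential of theta at 0.  Nondegeneracy makes Xi a submersion modulo
   that orthogonal complement, so a Graves type theorem provides points near
   ubar + e t(k) w and ubar + (1 - e) t(k) w whose images under Xi are
   e Xi(u(k)) and (1 - e) Xi(u(k)) up to such n.  Adding the two subgradient
   inequalities at these points cancels theta, and e -> 0 leaves the curvature
   of <lam, Xi>, which bounds the second subderivative from above. *)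
Require Import Defs.
From HB Require Import structures.
From mathcomp Require Import all_boot all_order all_algebra.
From mathcomp Require Import all_classical all_reals all_analysis.
From mathcomp Require Import ring lra.

Set Implicit Arguments.
Unset Strict Implicit.
Unset Printing Implicit Defensive.
Import Order.TTheory GRing.Theory Num.Theory.
Import numFieldNormedType.Exports.
Local Open Scope classical_set_scope.
Local Open Scope ring_scope.

(** * Inner product algebra and the Cauchy-Schwarz inequality *)

Lemma sqr_normr {R : realType} (a : R) : `|a| ^+ 2 = a ^+ 2.
Proof. by rewrite real_normK ?num_real. Qed.

Section InnerProduct.
Context {R : realType} {V : fdHilbertType R}.
Implicit Types (x y z v e : V) (a : R).

Lemma innerDr x y z : inner x (y + z) = inner x y + inner x z.
Proof. by rewrite innerC innerDl !(innerC _ x). Qed.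

Lemma innerZr a x y : inner x (a *: y) = a * inner x y.
Proof. by rewrite innerC innerZl innerC. Qed.

Lemma inner0l x : inner 0 x = 0.
Proof. by rewrite -(scale0r (0 : V)) innerZl mul0r. Qed.

Lemma inner0r x : inner x 0 = 0.
Proof. by rewrite innerC inner0l. Qed.

Lemma innerNl x y : inner (- x) y = - inner x y.
Proof. by rewrite -scaleN1r innerZl mulN1r. Qed.

Lemma innerNr x y : inner x (- y) = - inner x y.
Proof. by rewrite innerC innerNl innerC. Qed.

Lemma innerBl x y z : inner (x - y) z = inner x z - inner y z.
Proof. by rewrite innerDl innerNl. Qed.

Lemma innerBr x y z : inner x (y - z) = inner x y - inner x z.
Proof. by rewrite innerDr innerNr. Qed.

Lemma inner_suml (I : Type) (r : seq I) (F : I -> V) y :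
  inner (\sum_(i <- r) F i) y = \sum_(i <- r) inner (F i) y.
Proof.
elim: r => [|i r IH]; first by rewrite !big_nil inner0l.
by rewrite !big_cons innerDl IH.
Qed.

Lemma inner_eq0 x : inner x x = 0 -> x = 0.
Proof. by rewrite innerxx => /eqP; rewrite sqrf_eq0 normr_eq0 => /eqP. Qed.

Lemma innerl_inj x y : (forall h, inner x h = inner y h) -> x = y.
Proof.
move=> E; apply/eqP; rewrite -subr_eq0; apply/eqP/inner_eq0.
by rewrite innerBl E subrr.
Qed.

Lemma normB_sqr x y : `|x - y| ^+ 2 = `|x| ^+ 2 - 2 * inner x y + `|y| ^+ 2.
Proof. by rewrite -!innerxx !(innerBl, innerBr) (innerC y x); ring. Qed.

Lemma cauchy_schwarz x y : `|inner x y| <= `|x| * `|y|.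
Proof.
have [->|y0] := eqVneq y 0; first by rewrite inner0r !normr0 mulr0.
rewrite -(@ler_pXn2r _ 2) ?nnegrE ?mulr_ge0 // sqr_normr exprMn.
(* This square is [|y|^2] times the Gram determinant of [x] and [y]. *)
have : 0 <= `|(`|y| ^+ 2) *: x - inner x y *: y| ^+ 2 by rewrite sqr_ge0.
rewrite normB_sqr !normrZ innerZl innerZr !exprMn !sqr_normr.
set A := `|y| ^+ 2; set B := `|x| ^+ 2; set C := inner x y.
have A0 : 0 < A by rewrite exprn_gt0 ?normr_gt0.
rewrite (_ : _ - _ + _ = A * (B * A - C ^+ 2)); last by ring.
by rewrite pmulr_rge0 // subr_ge0.
Qed.

Lemma inner_le_norm x y : inner x y <= `|x| * `|y|.
Proof. exact: le_trans (ler_norm _) (cauchy_schwarz x y). Qed.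

End InnerProduct.

(** * Parseval frames, orthogonal projections, Riesz representation *)

Section Coordinates.
Context {R : realType} {V : fdHilbertType R}.
Implicit Types (x y z v e : V) (U : {vspace V}).

(** The frame operator of the list [b]. It is the orthogonal projection onto the span of [b] as soon
    as it fixes that span, as it does for the lists built in [parseval_span]. *)
Definition proj_seq (b : seq V) x := \sum_(e <- b) inner x e *: e.

Lemma inner_proj_seq b x y : inner (proj_seq b x) y = inner x (proj_seq b y).
Proof.
rewrite /proj_seq inner_suml (innerC x) inner_suml; apply: eq_bigr => e _.
by rewrite !innerZl mulrC (innerC e y) (innerC e x).
Qed.

(** Gram-Schmidt. A vector dependent on its predecessors yields [x' = 0], whose normalisation is
    again [0] and adds nothing to [proj_seq]. *)
Lemma parseval_span (S : seq V) : exists b : seq V,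
  {subset b <= <<S>>%VS} /\ forall z, z \in <<S>>%VS -> z = proj_seq b z.
Proof.
elim: S => [|x S [b [bs bP]]].
  exists [::]; split=> // z; rewrite span_nil memv0 => /eqP ->.
  by rewrite /proj_seq big_nil.
have pS z : proj_seq b z \in <<S>>%VS.
  by rewrite /proj_seq big_seq; apply: rpred_sum => e eb; rewrite rpredZ ?bs.
pose x' := x - proj_seq b x; pose n := `|x'|^-1 *: x'.
have x'o v : v \in <<S>>%VS -> inner x' v = 0.
  by move=> vs; rewrite innerBl inner_proj_seq -bP // subrr.
have sS : (<<S>> <= <<x :: S>>)%VS by rewrite span_cons addvSr.
have x'S : x' \in <<x :: S>>%VS.
  rewrite rpredB //; first by rewrite memv_span ?inE ?eqxx.
  exact: (subvP sS).
exists (n :: b); split=> [e|z].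
  rewrite inE => /orP[/eqP ->|/bs /(subvP sS) //].
  by rewrite rpredZ.
rewrite span_cons => /memv_addP[u /vlineP[a ->] [v vs ->]].
rewrite /proj_seq big_cons /n.
have -> : a *: x + v = a *: x' + (a *: proj_seq b x + v).
  by rewrite /x' scalerBr addrA subrK.
set y := a *: proj_seq b x + v.
have ys : y \in <<S>>%VS by rewrite rpredD ?rpredZ.
have -> : \sum_(e <- b) inner (a *: x' + y) e *: e = y.
  rewrite [RHS](bP _ ys) /proj_seq; apply: eq_big_seq => e eb.
  by rewrite innerDl innerZl x'o ?bs // mulr0 add0r.
congr (_ + _); rewrite innerZr innerDl innerZl innerxx (innerC y) (x'o _ ys).
rewrite addr0 scalerA; have [->|x0] := eqVneq x' 0; first by rewrite !scaler0.
congr (_ *: _); field; by rewrite normr_eq0.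
Qed.

Lemma parseval : exists b : seq V, forall z, z = proj_seq b z.
Proof.
have [b [_ bP]] := parseval_span (vbasis (fullv : {vspace V})).
by exists b => z; apply: bP; rewrite (span_basis (vbasisP _)) memvf.
Qed.

Lemma orth_proj U z : exists2 u, u \in U & forall v, v \in U -> inner (z - u) v = 0.
Proof.
have [b [bs bP]] := parseval_span (vbasis U).
rewrite (span_basis (vbasisP _)) in bs bP.
exists (proj_seq b z).
  by rewrite /proj_seq big_seq; apply: rpred_sum => e eb; rewrite rpredZ ?bs.
by move=> v vU; rewrite innerBl inner_proj_seq -bP // subrr.
Qed.

Lemma linear_proj_seq (W : lmodType R) (f : {linear V -> W}) b x :
  f (proj_seq b x) = \sum_(e <- b) inner x e *: f e.
Proof. by rewrite linear_sum; apply: eq_bigr => e _; rewrite linearZ. Qed.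

Lemma riesz (f : {linear V -> R}) : exists v, forall h, f h = inner v h.
Proof.
have [b bP] := parseval; exists (\sum_(e <- b) f e *: e) => h.
rewrite {1}(bP h) linear_proj_seq inner_suml; apply: eq_bigr => e _.
by rewrite innerZl innerC mulrC.
Qed.

Lemma linear_bound (W : normedModType R) (f : {linear V -> W}) :
  exists2 K : R, 0 < K & forall x, `|f x| <= K * `|x|.
Proof.
have [b bP] := parseval.
exists (1 + \sum_(e <- b) `|e| * `|f e|) => [|x].
  by rewrite ltr_wpDr ?ltr01 // sumr_ge0 // => e _; rewrite mulr_ge0.
rewrite {1}(bP x) linear_proj_seq.
apply: le_trans (ler_norm_sum _ _ _) _.
rewrite mulrDl mul1r mulr_suml ler_wpDl // ler_sum // => e _.
rewrite normrZ mulrAC ler_wpM2r // mulrC; exact: cauchy_schwarz.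
Qed.

End Coordinates.

(** * Convergent sequences and compactness *)

Section Sequences.
Context {R : realType} {V : fdHilbertType R}.

(** Polarisation reduces the claim to continuity of the norm. *)
Lemma cvg_inner (I : Type) (F : set_system I) {FF : Filter F} (x y : I -> V)
    (a b : V) : x @ F --> a -> y @ F --> b ->
  (fun k => inner (x k) (y k)) @ F --> inner a b.
Proof.
move=> xa yb.
have -> : (fun k => inner (x k) (y k)) =
    (fun k => 2^-1 * (`|x k| ^+ 2 + `|y k| ^+ 2 - `|x k - y k| ^+ 2)).
  by apply/funext => k; rewrite normB_sqr; field.
have -> : inner a b = 2^-1 * (`|a| ^+ 2 + `|b| ^+ 2 - `|a - b| ^+ 2).
  by rewrite normB_sqr; field.
have n2 (z : I -> V) c : z @ F --> c -> (fun k => `|z k| ^+ 2) @ F --> `|c| ^+ 2.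
  by move=> zc; rewrite expr2; under eq_fun do rewrite expr2; apply: cvgM;
    exact: cvg_norm.
apply: cvgM; first exact: cvg_cst.
by apply: cvgB; [apply: (cvgD (n2 _ _ xa) (n2 _ _ yb))|apply: n2; apply: cvgB].
Qed.

(** The condition [k <= s k] makes [s] tend to infinity and survives composition, hence repeated
    extraction. *)
Lemma cvg_subseq {T : topologicalType} (x : nat -> T) (l : T) (s : nat -> nat) :
  (forall k, (k <= s k)%N) -> x @ \oo --> l -> (x \o s) @ \oo --> l.
Proof.
move=> sk xl; apply: cvg_comp xl => A [N _ NA]; exists N => // k /= Nk.
by apply: NA => /=; apply: leq_trans Nk (sk k).
Qed.

(** The scalar Bolzano-Weierstrass theorem is applied to one frame coefficient after another, each
    time refining the previous subsequence. *)
Lemma bounded_cvg_subseq (x : nat -> V) (K : R) : (forall k, `|x k| <= K) ->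
  exists s l, (forall k, (k <= s k)%N) /\ (x \o s) @ \oo --> (l : V).
Proof.
move=> xK; have [b bP] := @parseval R V.
have [s sk sC] : exists2 s, (forall k, (k <= s k)%N) &
    forall e, e \in b -> cvgn (fun k => inner (x (s k)) e).
  elim: b {bP} => [|e b [s sk sb]]; first by exists id.
  have [|t tinc tC] := @bolzano_weierstrass R (fun k => inner (x (s k)) e).
    exists (K * `|e|); split; first exact: num_real.
    move=> M KM k _ /=; apply: le_trans (ltW KM).
    by apply: le_trans (cauchy_schwarz _ _) _; rewrite ler_wpM2r.
  have tk k : (k <= t k)%N.
    elim: k => // k IH; apply: leq_ltn_trans IH _.
    by have /increasing_seqP := tinc; apply.
  exists (s \o t) => [k|e']; first exact: leq_trans (tk k) (sk _).
  rewrite inE => /orP[/eqP -> //|/sb/cvg_ex[l sl]].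
  by apply/cvg_ex; exists l; apply: (cvg_subseq tk sl).
pose l := \sum_(e <- b) limn (fun k => inner (x (s k)) e) *: e.
exists s, l; split => //.
have -> : x \o s = (fun k => \sum_(e <- b) inner (x (s k)) e *: e).
  by apply/funext => k /=; rewrite {1}(bP (x (s k))).
rewrite /l {l bP}; elim: b sC => [|e b IH] sC.
  under eq_fun do rewrite big_nil; rewrite big_nil; exact: cvg_cst.
under eq_fun do rewrite big_cons; rewrite big_cons; apply: cvgD.
  by apply: cvgZr_tmp; apply: sC; rewrite inE eqxx.
by apply: IH => e' e'b; apply: sC; rewrite inE e'b orbT.
Qed.

End Sequences.

(** * Lower limits along [t] decreasing to zero and directions tending to [w] *)

Section LowerLimits.
Context {R : realType}.

Lemma ereal_between (r : R) (e : \bar R) :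
  (r%:E < e)%E -> exists2 r' : R, r < r' & (r'%:E < e)%E.
Proof.
case: e => [e| |] //; last by exists (r + 1); rewrite ?ltrDl ?ltr01 // ltry.
by rewrite lte_fin => re; exists ((r + e) / 2); rewrite ?lte_fin; lra.
Qed.

Lemma to_zero_pos_at_right (t : nat -> R) : to_zero_pos t ->
  t @ \oo --> (0 : R)^'+.
Proof.
move=> [t0 tz] A A0; have [N _ NA] := tz _ A0.
by exists N => // k /NA /=; apply; exact: t0.
Qed.

Context {V : normedModType R}.
Implicit Types (f : R * V -> \bar R) (w : V) (t : nat -> R) (u : nat -> V).

Lemma cvg_rays t u w : to_zero_pos t -> u @ \oo --> w ->
  (fun k => (t k, u k)) @ \oo --> filter_prod (0 : R)^'+ (nbhs w).
Proof.
move=> /to_zero_pos_at_right tz uw A [[B C] /= [B0 Cw] BC].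
have [N _ NB] := tz _ B0; have [M _ MC] := uw _ Cw.
exists (maxn N M) => // k /=; rewrite geq_max => /andP[Nk Mk].
by apply: BC; split; [exact: NB|exact: MC].
Qed.

(** Serves to bound first and second subderivatives from above along one well-chosen sequence. *)
Lemma limf_einf_le_seq f t u w (a : nat -> R) (l : R) :
  to_zero_pos t -> u @ \oo --> w ->
  (\forall k \near \oo, (f (t k, u k) <= (a k)%:E)%E) -> a @ \oo --> l ->
  (limf_einf f (filter_prod (0 : R)^'+ (nbhs w)) <= l%:E)%E.
Proof.
move=> tz uw fa al; rewrite limf_einfE; apply: ge_ereal_sup => _ [A FA <-].
have : \forall k \near \oo, (ereal_inf (f @` A) <= (a k)%:E)%E.
  near=> k; apply: le_trans (_ : f (t k, u k) <= _)%E; last by near: k.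
  apply: ereal_inf_lbound; exists (t k, u k) => //; near: k.
  exact: (cvg_rays tz uw FA).
case: (ereal_inf _) => [r| |] H; last exact: leNye.
- by rewrite lee_fin; apply: cvgr_to_ge al _.
- by have [N _ /(_ N)] := H; move=> /(_ (leqnn _)).
Unshelve. all: by end_near. Qed.

Lemma limf_einf_ge_near f w (l : \bar R) :
  (\forall p \near filter_prod (0 : R)^'+ (nbhs w), (l <= f p)%E) ->
  (l <= limf_einf f (filter_prod (0 : R)^'+ (nbhs w)))%E.
Proof.
move=> H; rewrite limf_einfE; apply: le_ereal_sup_tmp.
exists (ereal_inf (f @` [set p | (l <= f p)%E])).
  by exists [set p | (l <= f p)%E].
by apply: le_ereal_inf_tmp => _ [p lp <-].
Qed.

Lemma lt_limf_einf_seq f t u w (l : \bar R) : to_zero_pos t -> u @ \oo --> w ->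
  (l < limf_einf f (filter_prod (0 : R)^'+ (nbhs w)))%E ->
  \forall k \near \oo, (l < f (t k, u k))%E.
Proof.
move=> tz uw; rewrite limf_einfE => /ereal_sup_gt[_ [A FA <-]] lA.
have [N _ NA] := cvg_rays tz uw FA; exists N => // k /NA Ak.
by apply: lt_le_trans lA _; apply: ereal_inf_lbound; exists (t k, u k).
Qed.

End LowerLimits.

(** * Existence of minimisers by the direct method *)

Section Minimization.
Context {R : realType} {V : fdHilbertType R}.
Implicit Types (f g : V -> \bar R) (x y z : V).

Lemma lsc_argmin f (m K : R) x0 : lower_semicontinuous f ->
  (forall x, m%:E <= f x)%E -> (f x0 < +oo)%E ->
  (forall x, (f x <= f x0)%E -> `|x| <= K) -> exists x, argmin f x.
Proof.
move=> lsc mf fx0 fK; pose I := ereal_inf (range f).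
have mI : (m%:E <= I)%E by apply: le_ereal_inf_tmp => _ [x _ <-].
have If x : (I <= f x)%E by apply: ereal_inf_lbound; exists x.
have Ifin : I \is a fin_num.
  rewrite fin_numElt (lt_le_trans (ltNyr _) mI) /=.
  exact: le_lt_trans (If x0) fx0.
have /choice[x xP] : forall k, exists y,
    (f y < I + (k.+1%:R^-1)%:E)%E /\ (f y <= f x0)%E.
  move=> k; have k0 : (0 : R) < k.+1%:R^-1 by rewrite invr_gt0.
  have [_ [x _ <-] fx] := lb_ereal_inf_adherent k0 Ifin.
  (* If the near-infimal point lies above [f x0], then [x0] itself serves; the sequence thus stays
     in the bounded sublevel set. *)
  have [xx0|/ltW x0x] := leP (f x) (f x0); first by exists x.
  by exists x0; split=> //; exact: le_lt_trans x0x fx.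
have [s [l [sk sl]]] := bounded_cvg_subseq (fun k => fK _ (xP k).2).
suff fl : (f l <= I)%E by exists l => z; exact: le_trans fl (If z).
rewrite leNgt; apply/negP; rewrite -(fineK Ifin) => /ereal_between[r Ir].
move=> /lsc[A Al fA]; have /sl [N _ NA] := Al.
have r0 : 0 < r - fine I by rewrite subr_gt0.
have [M _ MA] := near_infty_natSinv_lt (PosNum r0).
have h := (xP (s (maxn N M))).1.
have : (r%:E < f (x (s (maxn N M))))%E by apply: fA; apply: NA; exact: leq_maxl.
move=> /lt_trans/(_ h); rewrite -{1}(fineK Ifin) lte_fin ltNge => /negP; apply.
rewrite -lerBrDl; apply/ltW/MA => /=.
exact: leq_trans (leq_maxr _ _) (sk _).
Qed.

Lemma lscD_continuous f (h : V -> R) : lower_semicontinuous f ->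
  continuous h -> lower_semicontinuous (fun z => f z + (h z)%:E)%E.
Proof.
move=> lsc hc x a; rewrite -lteBlDr // -EFinB => /ereal_between[r ar].
move=> /lsc[A Ax fA].
have : \forall y \near x, a - r < h y.
  by apply: (@cvgr_gt _ _ _ (nbhs_filter x) _ _ (hc x)); rewrite ltrBlDl -ltrBlDr.
move=> H; exists (A `&` [set y | a - r < h y]); first exact: filterI.
move=> y [/fA ry hy]; rewrite -lteBlDr // -EFinB.
by apply: le_lt_trans ry; rewrite lee_fin; move: hy => /=; lra.
Qed.

End Minimization.

(** * Convex analysis: proximal points and normal cones of polyhedra *)

Lemma quadratic_bound {R : realType} (q b d : R) : 0 <= q -> 0 <= b -> 0 <= d ->
  2^-1 * q ^+ 2 - b * q <= d -> q <= 2 * b + 2 + d.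
Proof. by move=> *; rewrite leNgt; apply/negP => ?; nra. Qed.

Section ConvexAnalysis.
Context {R : realType} {V : fdHilbertType R}.
Implicit Types (f g : V -> \bar R) (x y z : V).

Lemma subdifferential_fin f x v : subdifferential f x v -> exists a : R,
  f x = a%:E /\ forall z, ((a + inner v (z - x))%:E <= f z)%E.
Proof.
by case=> /fineK <- H; exists (fine (f x)); split=> // z; rewrite EFinD.
Qed.

Lemma normal_cone_monotone (C : set V) x y v w :
  normal_cone C x v -> normal_cone C y w -> 0 <= inner (v - w) (x - y).
Proof.
move=> [Cx vN] [Cy wN]; have := vN _ Cy; have := wN _ Cx.
by rewrite -(opprB x y) innerBl !innerNr; lra.
Qed.

(** The quadratic term dominates the affine minorant given by [v], so the objective is bounded below
    with bounded sublevel sets. *)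
Lemma prox_exists f x v : lower_semicontinuous f -> subdifferential f x v ->
  forall y, exists p, argmin (fun z => f z + (2^-1 * `|y - z| ^+ 2)%:E)%E p.
Proof.
move=> lsc /subdifferential_fin[a [fx va]] y.
have lb z : ((a + inner v (y - x) - `|v| * `|y - z| + 2^-1 * `|y - z| ^+ 2)%:E
    <= f z + (2^-1 * `|y - z| ^+ 2)%:E)%E.
  rewrite EFinD leeD2r //; apply: le_trans (va z); rewrite lee_fin.
  have -> : z - x = (y - x) - (y - z) by rewrite opprB [RHS]addrC addrA subrK.
  by rewrite (innerBr v (y - x)); have := inner_le_norm v (y - z); lra.
pose D : R := 2^-1 * `|y - x| ^+ 2 - inner v (y - x).
apply: (@lsc_argmin _ _ _ (a + inner v (y - x) - 2^-1 * `|v| ^+ 2)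
  (`|y| + (2 * `|v| + 2 + `|D|)) x).
- apply: lscD_continuous => // z; apply: cvgM; first exact: cvg_cst.
  under eq_fun do rewrite expr2; rewrite expr2.
  have H : (fun z' => `|y - z'|) @ z --> `|y - z|.
    by apply: cvg_norm; apply: cvgB; [exact: cvg_cst|exact: cvg_id].
  exact: cvgM.
- move=> z; apply: le_trans (lb z); rewrite lee_fin.
  have := sqr_ge0 (`|v| - `|y - z|); lra.
- by rewrite fx -EFinD ltry.
- move=> z /(le_trans (lb z)); rewrite fx -EFinD lee_fin => H.
  have -> : z = y - (y - z) by rewrite opprB addrC subrK.
  apply: le_trans (ler_normB _ _) _; rewrite lerD2l.
  have D1 : 2^-1 * `|y - z| ^+ 2 - `|v| * `|y - z| <= `|D|.
    apply: le_trans (ler_norm D); rewrite /D; lra.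
  exact: quadratic_bound D1.
Qed.

(** Fermat's rule at the proximal point [p]: compare [p] with [t z + (1 - t) p], divide by [t], and
    make the remaining term [t |z - p|^2 / 2] arbitrarily small. *)
Lemma prox_subdifferential f x v : proper_efun f -> lower_semicontinuous f ->
  convex_efun f -> subdifferential f x v ->
  forall y, subdifferential f (prox f y) (y - prox f y).
Proof.
move=> [fN _] lsc cvx fxv y; have /getPex := prox_exists lsc fxv y.
rewrite -/(prox f y); move: (prox f y) => p pmin.
have [a [fx _]] := subdifferential_fin fxv.
have fp : f p \is a fin_num.
  rewrite fin_numE fN /=; apply/eqP => fpy; have := pmin x.
  by rewrite fpy fx addye // leye_eq.
split=> // z; have [b fpb] : exists b, f p = b%:E by exists (fine (f p)); rewrite fineK.
rewrite fpb; case fz : (f z) => [c| |]; last by have := fN z; rewrite fz.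
  2: by rewrite leey.
rewrite -EFinD lee_fin.
have H t : 0 < t < 1 ->
    b + inner (y - p) (z - p) <= c + t * (2^-1 * `|z - p| ^+ 2).
  move=> t01; have := cvx z p t t01; rewrite fz fpb => H1.
  have := pmin (t *: z + (1 - t) *: p); rewrite fpb.
  move=> /le_trans/(_ (leeD2r _ H1)); rewrite -!EFinM -!EFinD lee_fin.
  have -> : y - (t *: z + (1 - t) *: p) = (y - p) - t *: (z - p).
    by rewrite scalerBl scale1r scalerBr addrCA opprD addrA.
  rewrite (normB_sqr (y - p)) innerZr normrZ exprMn sqr_normr.
  set q := `|z - p| ^+ 2; set s := inner _ _; set r := `|y - p| ^+ 2.
  move=> H2; have t0 : 0 < t by case/andP: t01.
  rewrite -(ler_pM2l t0); nra.
apply/ler_addgt0Pr => e e0; pose q := 2^-1 * `|z - p| ^+ 2.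
have q0 : 0 <= q by rewrite mulr_ge0 // sqr_ge0.
(* This value lies strictly between [0] and [1] and satisfies [t * q <= e]. *)
pose t := e / (1 + e + q).
have t01 : 0 < t < 1.
  by rewrite /t divr_gt0 ?ltr_pdivrMr; lra.
apply: le_trans (H t t01) _; rewrite lerD2l -/q /t mulrAC ler_pdivrMr; nra.
Qed.

(** Constraints inactive at [x] stay inactive at nearby [x'], while those active at [x] do not
    increase along [z - x]. Hence [x' + s (z - x)] is in [C] for small [s], and normality at [x']
    gives the inequality at [x]. *)
Lemma polyhedral_normal_cone_sub (C : set V) x : polyhedral C -> C x ->
  \forall x' \near x, normal_cone C x' `<=` normal_cone C x.
Proof.
move=> [m [a [b ->]]] Cx.
have near_inactive : \forall x' \near x, forall i,
    inner (a i) x < b i -> inner (a i) x' < b i.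
  apply: filter_forall => i; have [xb|xb] := boolP (inner (a i) x < b i); last first.
    by apply: nearW.
  have ac : (fun z => inner (a i) z) @ x --> inner (a i) x.
    by apply: cvg_inner; [exact: cvg_cst|exact: cvg_id].
  have H : \forall z \near x, inner (a i) z < b i by exact: cvgr_lt ac _ xb.
  by apply: filterS H.
apply: filterS near_inactive => x' H n [Cx' nN]; split=> // z Cz.
have [s s0 sC] : exists2 s, 0 < s & forall i, inner (a i) (x' + s *: (z - x)) <= b i.
  have Hi i : \forall s \near (0 : R)^'+, inner (a i) (x' + s *: (z - x)) <= b i.
    have [xb|xb] := ltP (inner (a i) x) (b i).
      have x'b := H i xb; pose c := inner (a i) (z - x).
      have c0 : 0 < 1 + `|c| by have := normr_ge0 c; lra.
      near=> s; rewrite innerDr innerZr.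
      have -> : b i = inner (a i) x' + (b i - inner (a i) x') by rewrite addrC subrK.
      rewrite lerD2l -/c.
      apply: le_trans (_ : s * (1 + `|c|) <= _).
        rewrite ler_wpM2l //; have := ler_norm c; lra.
      rewrite -ler_pdivlMr //.
      near: s; apply: nbhs_right_le; rewrite divr_gt0 ?subr_gt0 //.
    near=> s; rewrite innerDr innerZr innerBr.
    have s0 : 0 < s by [].
    have := Cx' i; have := Cz i; move=> h1 h2.
    have : s * (inner (a i) z - inner (a i) x) <= 0.
      by rewrite pmulr_rle0 // subr_le0; apply: le_trans xb.
    lra.
  have : \forall s \near (0 : R)^'+, 0 < s /\
      forall i, inner (a i) (x' + s *: (z - x)) <= b i.
    near=> s; split => //; near: s; exact: filter_forall.
  by move=> /filter_ex[s [s0 sC]]; exists s.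
have := nN _ sC; rewrite addrC addKr innerZr pmulr_rle0 //.
Unshelve. all: by end_near. Qed.

End ConvexAnalysis.

(** * Differentials along sequences and the mean value inequality *)

Section Differentials.
Context {R : realType} {V : fdHilbertType R}.
Implicit Types (x h c : V) (O : set V).

Lemma near0_ball (P : V -> Prop) : (\forall h \near (0 : V), P h) ->
  exists2 d : R, 0 < d & forall h, `|h| < d -> P h.
Proof. by move=> /nbhs_norm0P[d d0 dP]; exists d. Qed.

Section NormedTarget.
Context {W : normedModType R}.
Implicit Types (f : V -> W).

Lemma differentiable_near f x (e : R) : differentiable f x -> 0 < e ->
  exists2 d : R, 0 < d &
    forall h, `|h| < d -> `|f (x + h) - f x - 'd f x h| <= e * `|h|.
Proof.
move=> /diff_locallyP[_ /eqaddoP H] e0; apply: near0_ball.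
have := H _ e0; apply: filterS => h /=.
by rewrite !fctE /= opprD addrA (addrC h x).
Qed.

Lemma differentiable_seq f x (t : nat -> R) (u : nat -> V) w :
  differentiable f x -> to_zero_pos t -> u @ \oo --> w ->
  (fun k => (t k)^-1 *: (f (x + t k *: u k) - f x)) @ \oo --> 'd f x w.
Proof.
move=> df [t0 tz] uw.
have tu : (fun k => t k *: u k) @ \oo --> (0 : V).
  by rewrite -(scale0r w); apply: cvgZ.
have du : (fun k => 'd f x (u k)) @ \oo --> 'd f x w.
  by apply: continuous_cvg uw; apply: diff_continuous df w.
apply: cvg_sub0 du; apply/cvgrPdist_le => e e0.
have [K K0 uK] : exists2 K : R, 0 < K & \forall k \near \oo, `|u k| <= K.
  exists (`|w| + 1); first by rewrite ltr_wpDl.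
  apply: (@cvgr_le _ _ _ _ _ `|w|); [exact: cvg_norm|by rewrite ltrDl].
have eK : 0 < e / K by rewrite divr_gt0.
have [d d0 dP] := differentiable_near df eK.
near=> k; rewrite sub0r normrN !fctE /=.
have h : `|t k *: u k| < d.
  by near: k; apply: cvgr0_norm_lt.
have -> : (t k)^-1 *: (f (x + t k *: u k) - f x) - 'd f x (u k) =
   (t k)^-1 *: (f (x + t k *: u k) - f x - 'd f x (t k *: u k)).
  by rewrite linearZ [RHS]scalerBr scalerA mulVf ?scale1r // gt_eqF.
rewrite normrZ gtr0_norm ?invr_gt0 // mulrC ler_pdivrMr //.
apply: le_trans (dP _ h) _; rewrite normrZ gtr0_norm // mulrCA [leRHS]mulrC.
by rewrite ler_pM2l // mulrAC ler_pdivrMr // ler_pM2l //; near: k; exact: uK.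
Unshelve. all: by end_near. Qed.

Lemma diff_proj_seq f (b : seq V) x z : 'd f z (proj_seq b x) =
  \sum_(e <- b) inner x e *: 'd f z e.
Proof. exact: linear_proj_seq. Qed.

Lemma near0_ball_seq (b : seq V) (P : V -> V -> Prop) :
  (forall e, exists2 d : R, 0 < d & forall h, `|h| < d -> P e h) ->
  exists2 d : R, 0 < d & forall h, `|h| < d -> forall e, e \in b -> P e h.
Proof.
move=> H; elim: b => [|e b [d d0 dP]]; first by exists 1.
have [d' d'0 d'P] := H e; exists (Num.min d d') => [|h].
  by rewrite lt_min d0.
rewrite lt_min => /andP[hd hd'] e'; rewrite inE => /orP[/eqP ->|]; first exact: d'P.
exact: dP.
Qed.

Lemma sum_norm_bound (b : seq V) (F : V -> W) c (m : R) :
  (forall e, e \in b -> `|F e| <= m) ->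
  `|\sum_(e <- b) inner c e *: F e| <= m * (\sum_(e <- b) `|e|) * `|c|.
Proof.
move=> Fm; apply: le_trans (ler_norm_sum _ _ _) _.
rewrite mulr_sumr mulr_suml big_seq [leRHS]big_seq; apply: ler_sum => e eb.
rewrite normrZ mulrC -mulrA; apply: ler_pM => //; first exact: Fm.
by rewrite mulrC; exact: cauchy_schwarz.
Qed.

(** The estimate is proved on the finitely many frame vectors [e], where [z |-> 'd f z e] is
    differentiable at [x], and extends to every [c] by linearity. *)
Lemma C2_lipschitz f x : (forall e, differentiable (fun z => 'd f z e) x) ->
  exists d K : R, [/\ 0 < d, 0 < K & forall h c, `|h| < d ->
    `|'d f (x + h) c - 'd f x c| <= K * `|h| * `|c|].
Proof.
move=> df; have [b bP] := @parseval R V; set S := \sum_(e <- b) `|e|.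
have S0 : 0 <= S by apply: sumr_ge0.
have [L L0 LP] : exists2 L : R, 0 < L & forall e, e \in b ->
    forall h, `|'d (fun z => 'd f z e) x h| <= L * `|h|.
  elim: {bP S S0} b => [|e b [L L0 LP]]; first by exists 1.
  have [K K0 KP] := linear_bound ('d (fun z => 'd f z e) x).
  exists (Num.max K L) => [|e']; first by rewrite lt_max K0.
  rewrite inE => /orP[/eqP ->|e'b] h.
    by apply: le_trans (KP h) _; rewrite ler_wpM2r // le_max lexx.
  by apply: le_trans (LP _ e'b h) _; rewrite ler_wpM2r // le_max lexx orbT.
have [d d0 dP] := @near0_ball_seq b (fun e h =>
   `|'d f (x + h) e - 'd f x e - 'd (fun z => 'd f z e) x h| <= 1 * `|h|)
   (fun e => differentiable_near (df e) ltr01).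
exists d, ((1 + L) * S + 1); split=> // [|h c hd].
  by rewrite ltr_wpDl // mulr_ge0 // addr_ge0 // ltW.
rewrite {1 2}(bP c) !diff_proj_seq -sumrB.
under eq_bigr do rewrite -scalerBr.
apply: le_trans (_ : (1 + L) * `|h| * S * `|c| <= _); last first.
  by rewrite ler_wpM2r // mulrAC ler_wpM2r // lerDl.
apply: (@sum_norm_bound _ (fun e => 'd f (x + h) e - 'd f x e)) => e eb.
rewrite -[X in `|X|](subrK ('d (fun z => 'd f z e) x h)).
apply: le_trans (ler_normD _ _) _.
by rewrite mulrDl lerD //; [exact: dP|exact: LP].
Qed.

End NormedTarget.

Section HilbertTarget.
Context {W : fdHilbertType R}.
Implicit Types (f : V -> W).

Lemma is_derive_line f x c (s : R) (r : W) : differentiable f (x + s *: c) ->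
  is_derive s 1 (fun s => inner r (f (x + s *: c)))
    (inner r ('d f (x + s *: c) c)).
Proof.
move=> df; have H : derivable f (x + s *: c) c by exact: diff_derivable.
have C : (fun h : R => h^-1 *: (inner r (f (x + (h *: (1 : R) + s) *: c))
    - inner r (f (x + s *: c)))) @ 0^' --> inner r ('d f (x + s *: c) c).
  have -> : (fun h : R => h^-1 *: (inner r (f (x + (h *: (1 : R) + s) *: c))
    - inner r (f (x + s *: c)))) = (fun h : R => inner r
     (h^-1 *: (f (h *: c + (x + s *: c)) - f (x + s *: c)))).
    apply/funext => h; rewrite -innerBr innerZr; congr (_ * inner _ (f _ - _)).
    by rewrite scalerDl addrCA -[h *: 1]/(h * 1) mulr1.
  apply: cvg_inner; first exact: cvg_cst.
  by rewrite -deriveE //; apply: H.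
by apply: DeriveDef; [apply/cvg_ex; exists (inner r ('d f (x + s *: c) c))|
   apply: cvg_lim].
Qed.

(** Pairing with the error vector [r] itself reduces the claim to the scalar mean value theorem. The
    affine term [a + s b] covers first-order estimates, with [b = 0], as well as second-order ones,
    with [b] a second differential. *)
Lemma mean_value_inequality f x c (a b : W) (M : R) :
  (forall s, 0 <= s <= 1 -> differentiable f (x + s *: c)) ->
  (forall s, 0 <= s <= 1 -> `|'d f (x + s *: c) c - a - s *: b| <= M) ->
  `|f (x + c) - f x - a - 2^-1 *: b| <= M.
Proof.
move=> df fM; set r := f (x + c) - f x - a - 2^-1 *: b.
have [->|r0] := eqVneq r 0.
  by rewrite normr0; apply: le_trans (fM 0 _); rewrite ?lexx ?ler01.
pose q (s : R) :=
  inner r (f (x + s *: c)) - (s * inner r a + s ^+ 2 * (2^-1 * inner r b)).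
pose dq (s : R) := inner r ('d f (x + s *: c) c) - (inner r a + s * inner r b).
have qd (s : R) : 0 <= s <= 1 -> is_derive s 1 q (dq s).
  move=> s01; have H := is_derive_line r (df s s01).
  have : is_derive s 1 (fun s : R => s * inner r a + s ^+ 2 * (2^-1 * inner r b))
    (inner r a + s * inner r b).
    apply: is_derive_eq; by rewrite /GRing.scale /=; field.
  by move=> H2; exact: is_deriveB.
have [|||s s01 E] := @MVT_segment R q dq 0 1.
- exact: ler01.
- move=> s /andP[]; rewrite !bnd_simp => s0 s1; apply: qd; by rewrite !ltW.
- apply: derivable_within_continuous => s /andP[]; rewrite !bnd_simp => s0 s1.
  by have [] := qd s _; rewrite ?s0 ?s1.
have {}s01 : 0 <= s <= 1 by move: s01; rewrite in_itv.
have : `|r| ^+ 2 = dq s.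
  rewrite -innerxx {2}/r !innerBr innerZr; move: E.
  by rewrite /q scale0r scale1r addr0; lra.
have -> : dq s = inner r ('d f (x + s *: c) c - a - s *: b).
  by rewrite /dq !innerBr innerZr opprD addrA.
move=> E2; have := inner_le_norm r ('d f (x + s *: c) c - a - s *: b).
rewrite -E2 expr2 ler_pM2l ?normr_gt0 // => /le_trans; apply; exact: fM.
Qed.

End HilbertTarget.
End Differentials.

(** * Strict differentiability and second-order Taylor expansion *)

Section Taylor.
Context {R : realType} {V W : fdHilbertType R}.
Implicit Types (x h c : V) (O : set V) (f : V -> W).

Lemma near_add_ball x (P : V -> Prop) : (\forall z \near x, P z) ->
  exists2 d : R, 0 < d & forall h, `|h| < d -> P (x + h).
Proof.
move=> /nbhs_normP[d d0 dP]; exists d => // h hd; apply: dP => /=.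
by rewrite opprD addrA subrr add0r normrN.
Qed.

Lemma norm_convex_combination (a b : V) (d s : R) : 0 <= s <= 1 ->
  `|a| < d -> `|b| < d -> `|a + s *: (b - a)| < d.
Proof.
move=> /andP[s0 s1] ad bd.
have -> : a + s *: (b - a) = (1 - s) *: a + s *: b.
  by rewrite scalerBr scalerBl scale1r addrA addrAC.
apply: le_lt_trans (ler_normD _ _) _.
rewrite !normrZ (ger0_norm s0) ger0_norm ?subr_ge0 //.
have [->|s_neq0] := eqVneq s 0; first by rewrite subr0 mul1r mul0r addr0.
have sp : 0 < s by rewrite lt_def s_neq0.
have : s * `|b| < s * d by rewrite ltr_pM2l.
have : (1 - s) * `|a| <= (1 - s) * d by rewrite ler_wpM2l ?subr_ge0 // ltW.
lra.
Qed.

(** On the segment joining the two points the differential stays close to ['d f x], by continuity on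
    each frame vector; the mean value inequality turns this into the estimate. *)
Lemma strict_differentiability O f x (e : R) : open O -> O x -> C1_on O f -> 0 < e ->
  exists2 d : R, 0 < d & forall h1 h2, `|h1| < d -> `|h2| < d ->
    `|f (x + h1) - f (x + h2) - 'd f x (h1 - h2)| <= e * `|h1 - h2|.
Proof.
move=> oO Ox [df dc] e0; have [b bP] := @parseval R V.
set S := \sum_(e <- b) `|e|.
have S1 : 0 < 1 + S by rewrite ltr_wpDr // sumr_ge0.
have e'0 : 0 < e / (1 + S) by rewrite divr_gt0.
have [d1 d10 d1P] : exists2 d : R, 0 < d & forall h, `|h| < d -> forall v, v \in b ->
    `|'d f (x + h) v - 'd f x v| <= e / (1 + S).
  apply: (@near0_ball_seq _ _ _
    (fun v h => `|'d f (x + h) v - 'd f x v| <= e / (1 + S))).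
  move=> v; apply: (@near_add_ball _ (fun z => `|'d f z v - 'd f x v| <= e / (1 + S))).
  by move/cvgrPdistC_le: (dc v x Ox); apply.
have [d2 d20 d2P] := near_add_ball (open_nbhs_nbhs (conj oO Ox)).
exists (Num.min d1 d2) => [|h1 h2]; first by rewrite lt_min d10.
rewrite !lt_min => /andP[h11 h12] /andP[h21 h22].
set c := h1 - h2.
have seg s : 0 <= s <= 1 -> x + h2 + s *: c = x + (h2 + s *: c) by rewrite addrA.
have -> : x + h1 = (x + h2) + c by rewrite -addrA (addrC h2) subrK.
rewrite -[X in `|X|]subr0 -(scaler0 _ 2^-1).
apply: mean_value_inequality => s s01; rewrite seg //.
  by apply/df/d2P/norm_convex_combination.
have dE z : 'd f z c = \sum_(v <- b) inner c v *: 'd f z v.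
  by rewrite {1}(bP c) diff_proj_seq.
rewrite scaler0 subr0 !dE -sumrB.
under eq_bigr do rewrite -scalerBr.
apply: le_trans (_ : e / (1 + S) * S * `|c| <= _).
  apply: (@sum_norm_bound _ _ _ b (fun v => 'd f (x + (h2 + s *: c)) v - 'd f x v)).
  by apply: d1P; apply: norm_convex_combination.
rewrite ler_wpM2r // mulrAC ler_pdivrMr // ler_pM2l // lerDr //.
Qed.

(** The second differential at [x]: [h] is the direction of the inner derivative, held fixed while
    the base point moves along [c]. *)
Definition second_diff f x h c := 'd (fun z => 'd f z h) x c.

Section SecondDifferential.
Variables (O : set V) (f : V -> W) (x : V).
Hypotheses (oO : open O) (Ox : O x) (fC2 : C2_on O f).

Let df h : differentiable (fun z => 'd f z h) x.
Proof. by have [_ /(_ h)[+ _]] := fC2; exact. Qed.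

Lemma second_diffZl a h c : second_diff f x (a *: h) c = a *: second_diff f x h c.
Proof.
rewrite /second_diff; have -> : (fun z => 'd f z (a *: h)) = a *: (fun z => 'd f z h).
  by apply/funext => z; rewrite linearZ.
exact: (congr1 (fun F => F c) (diffZ a (df h))).
Qed.

Lemma second_diffDl h1 h2 c :
  second_diff f x (h1 + h2) c = second_diff f x h1 c + second_diff f x h2 c.
Proof.
rewrite /second_diff; have -> : (fun z => 'd f z (h1 + h2)) =
    (fun z => 'd f z h1) + (fun z => 'd f z h2).
  by apply/funext => z; rewrite linearD.
exact: (congr1 (fun F => F c) (diffD (df h1) (df h2))).
Qed.

Lemma second_diff_proj_seq (b : seq V) h c :
  second_diff f x (proj_seq b h) c = \sum_(e <- b) inner h e *: second_diff f x e c.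
Proof.
rewrite /proj_seq; elim: b => [|e b IH].
  by rewrite !big_nil -(scale0r (0 : V)) second_diffZl scale0r.
by rewrite !big_cons second_diffDl second_diffZl IH.
Qed.

Lemma second_diffZr a h c : second_diff f x h (a *: c) = a *: second_diff f x h c.
Proof. by rewrite /second_diff linearZ. Qed.

Lemma cvg_second_diff (u : nat -> V) w : u @ \oo --> w ->
  (fun k => second_diff f x (u k) (u k)) @ \oo --> second_diff f x w w.
Proof.
move=> uw; have [b bP] := @parseval R V.
have D v : second_diff f x v v = \sum_(e <- b) inner v e *: second_diff f x e v.
  by rewrite {1}(bP v) second_diff_proj_seq.
rewrite D; under eq_fun => k do rewrite D.
apply: (@cvg_big W V +%R 0 xpredT (@add_continuous W)) => e _.
apply: cvgZ; first by apply: cvg_inner => //; exact: cvg_cst.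
by apply: continuous_cvg uw; apply: diff_continuous (df e) w.
Qed.

(** The mean value inequality with [a] the first and [b] the second differential; differentiability
    of [z |-> 'd f z v] at [x] on frame vectors bounds the derivative error by [e |c|^2]. *)
Lemma taylor2 (e : R) : 0 < e -> exists2 d : R, 0 < d & forall c, `|c| < d ->
  `|f (x + c) - f x - 'd f x c - 2^-1 *: second_diff f x c c| <= e * `|c| ^+ 2.
Proof.
move=> e0; have [b bP] := @parseval R V.
set S := \sum_(e <- b) `|e|.
have S1 : 0 < 1 + S by rewrite ltr_wpDr // sumr_ge0.
have e'0 : 0 < e / (1 + S) by rewrite divr_gt0.
have [d1 d10 d1P] := @near0_ball_seq _ _ b (fun v h =>
  `|'d f (x + h) v - 'd f x v - second_diff f x v h| <= e / (1 + S) * `|h|)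
  (fun v => differentiable_near (df v) e'0).
have [d2 d20 d2P] := near_add_ball (open_nbhs_nbhs (conj oO Ox)).
exists (Num.min d1 d2) => [|c]; first by rewrite lt_min d10.
rewrite lt_min => /andP[cd1 cd2].
have sc (s : R) : 0 <= s <= 1 -> `|s *: c| <= `|c|.
  by move=> /andP[s0 s1]; rewrite normrZ ger0_norm // ler_piMl.
apply: mean_value_inequality => s s01.
  by apply: fC2.1; apply: d2P; exact: le_lt_trans (sc _ s01) cd2.
have dE z : 'd f z c = \sum_(v <- b) inner c v *: 'd f z v.
  by rewrite {1}(bP c) diff_proj_seq.
have d2E : second_diff f x c c = \sum_(v <- b) inner c v *: second_diff f x v c.
  by rewrite {1}(bP c) second_diff_proj_seq.
rewrite !dE d2E -sumrB scaler_sumr -sumrB.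
under eq_bigr => v _.
  rewrite -scalerBr scalerA (mulrC s) -scalerA -second_diffZr -scalerBr; over.
apply: le_trans (_ : e / (1 + S) * `|c| * S * `|c| <= _).
  apply: (@sum_norm_bound _ _ _ b (fun v =>
    'd f (x + s *: c) v - 'd f x v - second_diff f x v (s *: c))) => v vb.
  apply: le_trans (d1P _ _ _ vb) _; first exact: le_lt_trans (sc _ s01) cd1.
  by rewrite ler_wpM2l ?(ltW e'0) //; exact: sc.
rewrite expr2 mulrA ler_wpM2r // mulrAC ler_wpM2r // mulrAC ler_pdivrMr //.
by rewrite ler_pM2l // lerDr.
Qed.

Lemma taylor2_seq (t : nat -> R) (u : nat -> V) w : to_zero_pos t ->
  u @ \oo --> w ->
  (fun k => (t k ^+ 2)^-1 *: (f (x + t k *: u k) - f x - t k *: 'd f x (u k)))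
    @ \oo --> 2^-1 *: second_diff f x w w.
Proof.
move=> [t0 tz] uw.
have tu : (fun k => t k *: u k) @ \oo --> (0 : V).
  by rewrite -(scale0r w); apply: cvgZ.
have Qu : (fun k => 2^-1 *: second_diff f x (u k) (u k)) @ \oo -->
    2^-1 *: second_diff f x w w.
  by apply: cvgZ; [exact: cvg_cst|exact: cvg_second_diff].
apply: cvg_sub0 Qu; apply/cvgrPdist_le => e e0.
have K0 : 0 < `|w| + 1 by rewrite ltr_wpDl.
have uK : \forall k \near \oo, `|u k| <= `|w| + 1.
  by apply: (@cvgr_le _ _ _ _ _ `|w|); [exact: cvg_norm|rewrite ltrDl].
have eK : 0 < e / (`|w| + 1) ^+ 2 by rewrite divr_gt0 // exprn_gt0.
have [d d0 dP] := taylor2 eK.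
near=> k; rewrite sub0r normrN !fctE /=.
have h : `|t k *: u k| < d.
  by near: k; apply: cvgr0_norm_lt.
have t20 : 0 < t k ^+ 2 by rewrite exprn_gt0.
have -> : (t k ^+ 2)^-1 *: (f (x + t k *: u k) - f x - t k *: 'd f x (u k)) -
    2^-1 *: second_diff f x (u k) (u k) =
   (t k ^+ 2)^-1 *: (f (x + t k *: u k) - f x - 'd f x (t k *: u k) -
    2^-1 *: second_diff f x (t k *: u k) (t k *: u k)).
  rewrite second_diffZl second_diffZr.
  have -> : 'd f x (t k *: u k) = t k *: 'd f x (u k) by rewrite linearZ.
  rewrite [RHS]scalerBr !scalerA; congr (_ - _ *: _).
  by field; rewrite gt_eqF.
rewrite normrZ gtr0_norm ?invr_gt0 // mulrC ler_pdivrMr //.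
apply: le_trans (dP _ h) _; rewrite normrZ gtr0_norm // exprMn mulrCA [leRHS]mulrC.
rewrite ler_pM2l // mulrAC ler_pdivrMr ?exprn_gt0 // ler_pM2l //.
by rewrite ler_pXn2r ?nnegrE ?(ltW K0) //; near: k; exact: uK.
Unshelve. all: by end_near. Qed.

End SecondDifferential.
End Taylor.

(** * Sublinear functions and their subgradients at the origin *)

Section Sublinear.
Context {R : realType} {Z : fdHilbertType R}.
Variable theta : Z -> \bar R.
Hypotheses (theta_proper : proper_efun theta) (theta_lsc : lower_semicontinuous theta)
  (theta_sublinear : sublinear theta).
Implicit Types (z n c p : Z).

Lemma sublinear0 : theta 0 = 0%E.
Proof.
have [N _] := theta_proper; have [t0 tZ _] := theta_sublinear.
have := tZ 2 0 ltac:(lra); rewrite scaler0.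
case: (theta 0) t0 (N 0) => [r| |] // _ _ [H]; congr EFin; lra.
Qed.

Lemma sublinear_convex : convex_efun theta.
Proof.
have [_ tZ tD] := theta_sublinear; move=> x y t /andP[t0 t1].
by apply: le_trans (tD _ _) _; rewrite !tZ // subr_gt0.
Qed.

(** Positive homogeneity: the subgradient inequality at [2 p] and at [p / 2] pins the value at [p]
    to [<c, p>]. *)
Lemma sublinear_subdifferential p c : subdifferential theta p c ->
  subdifferential theta 0 c /\ theta p = (inner c p)%:E.
Proof.
have [_ tZ tD] := theta_sublinear.
move=> /subdifferential_fin[a [pa H]].
have aE : a = inner c p.
  have := H (2 *: p); have := H (2^-1 *: p).
  rewrite !tZ ?pa ?invr_gt0 ?ltr0n // !lee_fin !innerBr !innerZr; lra.
split; last by rewrite pa aE.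
split=> [|z]; rewrite sublinear0 // add0e subr0.
by apply: le_trans (H z); rewrite lee_fin innerBr aE; lra.
Qed.

Lemma sublinear_le_inner c0 n : subdifferential theta 0 c0 ->
  (forall c, subdifferential theta 0 c -> inner c n = inner c0 n) ->
  (theta n <= (inner c0 n)%:E)%E.
Proof.
move=> c0C nC; have [_ tZ _] := theta_sublinear.
rewrite leNgt; apply/negP => /ereal_between[r c0r] /theta_lsc[A nA tA].
pose p k := prox theta (k.+1%:R *: n); pose c k := k.+1%:R *: n - p k.
have cP k : subdifferential theta (p k) (c k).
  exact: prox_subdifferential sublinear_convex c0C _.
have pE v k : inner v (p k) = k.+1%:R * inner v n - inner v (c k).
  by rewrite -innerZr -innerBr /c opprB addrC subrK.
have cc0 k : `|c k| <= `|c0|.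
  have [ck0 tp] := sublinear_subdifferential (cP k).
  have [_ /(_ (p k))] := c0C; rewrite sublinear0 add0e subr0 tp lee_fin.
  rewrite !pE (nC _ ck0) lerD2l lerN2 innerxx => H.
  have := le_trans H (inner_le_norm _ _); rewrite expr2.
  have [->|ck] := eqVneq (c k) 0; first by rewrite normr0.
  by rewrite ler_pM2r ?normr_gt0.
have pn : (fun k => (k.+1%:R^-1 : R) *: p k) @ \oo --> n.
  have -> : (fun k => k.+1%:R^-1 *: p k) = (fun k => n - (k.+1%:R^-1 : R) *: c k).
    apply/funext => k; rewrite /c scalerBr scalerA mulVf ?pnatr_eq0 // scale1r.
    by rewrite opprB addrC subrK.
  rewrite -[X in _ --> X]subr0; apply: cvgB; first exact: cvg_cst.
  apply/cvgr0Pnorm_le => e e0.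
  have e'0 : 0 < e / (1 + `|c0|) by rewrite divr_gt0 // ltr_wpDr.
  have := near_infty_natSinv_lt (PosNum e'0); apply: filterS => k /= ke.
  rewrite normrZ gtr0_norm ?invr_gt0 //.
  apply: le_trans (_ : e / (1 + `|c0|) * (1 + `|c0|) <= _); last first.
    by rewrite mulfVK // gt_eqF // ltr_wpDr.
  by apply: ler_pM => //; [exact: ltW|apply: le_trans (cc0 k) _; rewrite lerDr].
have [M _ /(_ M (leqnn _)) /= /tA] := pn _ nA; rewrite tZ ?invr_gt0 //.
have [ck0 ->] := sublinear_subdifferential (cP M).
rewrite -EFinM lte_fin ltNge => /negP; apply; apply: le_trans (ltW c0r).
rewrite pE (nC _ ck0) innerxx mulrBr mulKf ?pnatr_eq0 // gerBl.
by rewrite mulr_ge0 ?sqr_ge0.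
Qed.

(** Subadditivity gives both inequalities once the preceding bound is applied to [n] and to
    [- n]. *)
Lemma sublinear_translate c0 n : subdifferential theta 0 c0 ->
  (forall c, subdifferential theta 0 c -> inner c n = inner c0 n) ->
  forall z, theta (z + n) = (theta z + (inner c0 n)%:E)%E.
Proof.
move=> c0C nC z; have [_ _ tD] := theta_sublinear.
have le1 := sublinear_le_inner c0C nC.
have := @sublinear_le_inner c0 (- n) c0C; rewrite innerNr => le2.
have {}le2 := le2 (fun c cC => ltac:(by rewrite innerNr nC)).
apply/eqP; rewrite eq_le; apply/andP; split.
  by apply: le_trans (tD _ _) _; rewrite leeD2l.
rewrite -leeBrDr // -EFinN -{1}(addrK n z).
by apply: le_trans (tD _ _) _; rewrite leeD2l.
Qed.

End Sublinear.

(** * Linear subspaces and the subspace parallel to a set *)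

Section LinearAlgebra.
Context {R : realType} {V Z : fdHilbertType R}.

(** Take a subspace inside [S] of maximal dimension: adjoining a point of [S] cannot raise the
    dimension, so that point already belongs to it. *)
Lemma vspace_of_set (S : set V) : S 0 ->
  (forall a x y, S x -> S y -> S (a *: x + y)) ->
  exists U : {vspace V}, forall z, z \in U <-> S z.
Proof.
move=> S0 Slin; pose P n := `[< exists U : {vspace V},
  (forall z, z \in U -> S z) /\ \dim U = n >].
have P0 : exists n, P n.
  exists 0%N; apply/asboolP; exists 0%VS; split; last by rewrite dimv0.
  by move=> z; rewrite memv0 => /eqP ->.
have Pb n : P n -> (n <= \dim (fullv : {vspace V}))%N.
  by move=> /asboolP[U [_ <-]]; rewrite dimvS ?subvf.
have [n /asboolP[U [US dU]] nmax] := ex_maxnP P0 Pb.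
exists U => z; split=> [|Sz]; first exact: US.
have : P (\dim (U + <[z]>)%VS).
  apply/asboolP; exists (U + <[z]>)%VS; split=> // y.
  move=> /memv_addP[u uU [v /vlineP[a ->] ->]].
  by rewrite addrC; apply: Slin => //; exact: US.
move=> /nmax; rewrite -dU => dle.
have : (U == U + <[z]>)%VS by rewrite eqEdim addvSl.
by move=> /eqP ->; rewrite (subvP (addvSr _ _)) // memv_line.
Qed.

Lemma par_vspace (C : set V) a : aff C a ->
  exists U : {vspace V}, forall z, z \in U <-> par C z.
Proof.
have affD x y t : aff C x -> aff C y -> aff C ((1 - t) *: x + t *: y).
  by move=> Cx Cy B BP; apply: BP.1; [exact: Cx BP|exact: Cy BP].
have affS x y z : aff C x -> aff C y -> aff C z -> aff C (x + y - z).
  (* [x + y - z] is the reflection of [z] through the midpoint of [x] and [y]. *)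
  move=> Cx Cy Cz; have := affD _ _ 2 Cz (affD _ _ 2^-1 Cx Cy).
  have -> : 1 - 2 = -1 :> R by ring.
  rewrite scalerDr !scalerA (_ : 2 * (1 - 2^-1) = 1) ?mulfV ?pnatr_eq0 //.
    by rewrite scaleN1r !scale1r addrC.
  by field.
move=> Ca; apply: vspace_of_set => [|t _ _ [x Cx [y Cy <-]] [z Cz [w Cw <-]]].
  by exists a => //; exists a => //; rewrite subrr.
exists ((1 - t) *: y + t *: x + z - y); first by apply: affS => //; exact: affD.
exists w => //; rewrite scalerBl scale1r scalerBr !addrA; congr (_ - _).
by rewrite [LHS]addrC !addrA addNr add0r (addrC (- _)).
Qed.

Lemma par_diff (C : set V) c c' : C c -> C c' -> par C (c - c').
Proof. by move=> Cc Cc'; exists c; [|exists c'] => // A [_]; exact. Qed.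

End LinearAlgebra.

(** * Continuity of linear maps; a right inverse from nondegeneracy *)

Section ProjSeqLinear.
Context {R : realType} {V : fdHilbertType R}.
Variable b : seq V.

Lemma proj_seq_is_linear : linear (proj_seq b).
Proof.
move=> a x y; rewrite /proj_seq scaler_sumr -big_split /=.
by apply: eq_bigr => e _; rewrite innerDl innerZl scalerDl scalerA.
Qed.

HB.instance Definition _ := GRing.isLinear.Build R V V *:%R (proj_seq b)
  proj_seq_is_linear.

End ProjSeqLinear.

Lemma linear_continuous_fd {R : realType} {V : fdHilbertType R}
  {W : normedModType R} (f : {linear V -> W}) : continuous f.
Proof.
have [K K0 KP] := linear_bound f; apply/bounded_linear_continuous/linear_boundedP.
near=> r => x; apply: le_trans (KP x) _; rewrite ler_wpM2r //.
Unshelve. all: by end_near. Qed.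

Section RightInverse.
Context {R : realType} {Y Z : fdHilbertType R}.

Lemma adjoint0 (A : {linear Y -> Z}) z : (forall y, inner z (A y) = 0) ->
  adjoint A z = 0.
Proof.
move=> zA; have /getPex H : exists v, forall h, inner z (A h) = inner v h.
  by exists 0 => h; rewrite zA inner0l.
by apply: innerl_inj => h; rewrite -H zA inner0l.
Qed.

(** [P] is the orthogonal projection onto [par C]. Nondegeneracy says that no nonzero vector of
    [par C] is orthogonal to the image of [A], so [P] composed with [A] maps onto [par C] and [B]
    can be a linear section of it. *)
Lemma nondegenerate_right_inverse (A : {linear Y -> Z}) (C : set Z) :
  par C `&` [set z | adjoint A z = 0] = [set 0] ->
  exists (P : {linear Z -> Z}) (B : {linear Z -> Y}),
    (forall n, P n = 0 -> forall c c', C c -> C c' -> inner (c - c') n = 0) /\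
    forall z, P (A (B (P z))) = P z.
Proof.
move=> nd; have [[a Ca _] _] : (par C `&` [set z | adjoint A z = 0]) 0 by rewrite nd.
have [U UP] := par_vspace Ca.
have [b [bU bP]] := parseval_span (vbasis U).
rewrite (span_basis (vbasisP _)) in bU bP.
pose g : 'Hom(Y, Z) := linfun (proj_seq b \o A).
have PU z : proj_seq b z \in U.
  by rewrite /proj_seq big_seq; apply: rpred_sum => e eb; rewrite rpredZ ?bU.
have gE (y : Y) : g y = proj_seq b (A y) by rewrite lfunE.
have gU u : u \in limg g -> u \in U by move=> /memv_imgP[y _ ->]; rewrite gE.
have surj z : z \in U -> z \in limg g.
  move=> zU; have [u ug uo] := orth_proj (limg g) z.
  suff -> : z = u by [].
  apply/eqP; rewrite -subr_eq0; apply/eqP.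
  (* The defect [z - u] lies in [par C] and is orthogonal to the image of [A], hence vanishes. *)
  have dU : z - u \in U by rewrite rpredB // gU.
  have : (par C `&` [set z | adjoint A z = 0]) (z - u).
    split; first exact/UP.
    apply: adjoint0 => y; rewrite (bP _ dU) inner_proj_seq.
    have <- : g y = proj_seq b (A y) by exact: gE.
    by apply: uo; rewrite memv_img ?memvf.
  by rewrite nd.
exists (proj_seq b), (g^-1)%VF; split=> [n Pn c c' Cc Cc'|z].
  have /UP dU := par_diff Cc Cc'.
  by rewrite (bP _ dU) inner_proj_seq Pn inner0r.
by rewrite /= -gE limg_lfunVK // surj.
Qed.

End RightInverse.

(** * A Graves type theorem modulo the kernel of a projection *)

Section Graves.
Context {R : realType} {V Z : fdHilbertType R}.

(** Setting the function to [+oo] off the closed ball keeps it lower semicontinuous and makes its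
    sublevel sets bounded. *)
Lemma ball_argmin (m : V -> R) (r : R) : 0 <= r -> (forall x, 0 <= m x) ->
  (forall x, `|x| <= r -> {for x, continuous m}) ->
  exists2 x, `|x| <= r & forall y, `|y| <= r -> m x <= m y.
Proof.
move=> r0 m0 mc.
pose f x : \bar R := if `|x| <= r then (m x)%:E else +oo%E.
have [|||x|x xmin] := @lsc_argmin _ _ f 0 r 0.
- move=> x a ax; have [xr|xr] := leP `|x| r.
    move: ax; rewrite /f xr lte_fin => ax.
    exists [set y | a < m y]; first exact: (cvgr_gt (m x) (mc _ xr)).
    by move=> y /= ay; case: ifP => _; rewrite ?lte_fin ?ltry.
  exists [set y : V | r < `|y|].
    by apply: (cvgr_gt `|x|) => //; exact: norm_continuous.
  by move=> y /= ry; rewrite /f leNgt ry /= ltry.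
- by move=> x; rewrite /f; case: ifP => _; rewrite ?lee_fin ?leey.
- by rewrite /f normr0 r0 ltry.
- by rewrite /f normr0 r0; case: ifP.
- have xr : `|x| <= r.
    by have := xmin 0; rewrite /f normr0 r0; case: ifP.
  by exists x => // y yr; have := xmin y; rewrite /f xr yr lee_fin.
Qed.

(* The minimiser over a ball of the residual plus a small multiple of the norm
   has zero residual: otherwise a Newton step would decrease the objective. *)
Lemma graves (O : set V) (F : V -> Z) (x : V) (P : {linear Z -> Z})
    (B : {linear Z -> V}) : open O -> O x -> C1_on O F ->
  (forall z, P ('d F x (B (P z))) = P z) ->
  exists d K : R, [/\ 0 < d, 0 < K & forall c z, `|c| <= d ->
    `|F (x + c) - z| <= d ->
    exists2 v, `|v| <= K * `|F (x + c) - z| & P (F (x + (c + v)) - z) = 0].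
Proof.
move=> oO Ox FC1 PAB.
have [KB KB0 KBP] := linear_bound B; have [KP KP0 KPP] := linear_bound P.
(* A step of size [s] shrinks [P w] by the factor [1 - s]. These constants make the linearisation
   error and the growth of the norm penalty cost at most [s |P w| / 4] each. *)
pose e := (4 * KB * KP)^-1; pose al := (4 * KB)^-1.
have e0 : 0 < e by rewrite invr_gt0 !mulr_gt0.
have al0 : 0 < al by rewrite invr_gt0 mulr_gt0.
have eK : KP * (e * KB) = 4^-1.
  by rewrite /e; field; rewrite !gt_eqF.
have alK : al * KB = 4^-1 by rewrite /al; field; rewrite gt_eqF.
have [d1 d10 strict] := strict_differentiability oO Ox FC1 e0.
have [d2 d20 ballO] := near_add_ball (open_nbhs_nbhs (conj oO Ox)).
pose r := Num.min d1 d2 / 3.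
have r0 : 0 < r by rewrite divr_gt0 // lt_min d10.
have r1 : r + r < d1.
  rewrite /r; have : Num.min d1 d2 <= d1 by rewrite ge_min lexx.
  lra.
have r2 : r + r < d2.
  rewrite /r; have : Num.min d1 d2 <= d2 by rewrite ge_min lexx orbT.
  lra.
(* The second bound forces [|v| <= r / 2] for the minimiser, which leaves room for a step inside the
   ball. *)
exists (Num.min r (r * al / (2 * KP))), (KP / al); split.
- by rewrite lt_min r0 /=; apply: divr_gt0; apply: mulr_gt0.
- by rewrite divr_gt0.
move=> c z; rewrite !le_min => /andP[cr _] /andP[_ zr].
have cv v : `|v| <= r -> `|c + v| <= r + r.
  by move=> vr; apply: le_trans (ler_normD _ _) _; exact: lerD.
pose m v := `|P (F (x + (c + v)) - z)| + al * `|v|.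
have [||v|v vr vmin] := @ball_argmin m r.
- exact: ltW.
- by move=> v; rewrite addr_ge0 // mulr_ge0 // ltW.
- move=> vr; apply: cvgD; last first.
    by apply: cvgM; [exact: cvg_cst|exact: norm_continuous].
  apply: cvg_norm.
  have Pc : continuous P.
    exact: linear_continuous_fd.
  apply: continuous_cvg; first exact: Pc.
  apply: cvgB; last exact: cvg_cst.
  have FC : {for x + (c + v), continuous F}.
    by apply: differentiable_continuous; apply/FC1.1/ballO/(le_lt_trans (cv _ vr)).
  apply: (@continuous_comp _ _ _ (fun v => x + (c + v)) F v) => //.
  by apply: cvgD; [exact: cvg_cst|apply: cvgD; [exact: cvg_cst|exact: cvg_id]].
have mv : `|v| <= KP / al * `|F (x + c) - z|.
  have := vmin 0; rewrite normr0 ltW // => /(_ isT).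
  rewrite /m normr0 mulr0 !addr0 => H.
  rewrite mulrAC ler_pdivlMr // mulrC; apply: le_trans (KPP _).
  by apply: le_trans H; rewrite lerDr.
exists v => //; apply/eqP; apply/negPn/negP => Pz.
have Pz0 : 0 < `|P (F (x + (c + v)) - z)| by rewrite normr_gt0.
have vr' : `|v| < r.
  apply: le_lt_trans mv _; rewrite mulrAC ltr_pdivrMr //.
  apply: le_lt_trans (_ : r * al / 2 < _); last first.
    by have := mulr_gt0 r0 al0; lra.
  by move: zr; rewrite ler_pdivlMr ?mulr_gt0 //; lra.
set w := F (x + (c + v)) - z in Pz Pz0.
pose h := B (P w).
have hK : `|h| <= KB * `|P w| by exact: KBP.
(* Chosen so that [0 < s <= 1] and [v - s h] stays in the ball of radius [r]. *)
pose s := (r - `|v|) / (r - `|v| + 1 + `|h|).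
have D0 : 0 < r - `|v| + 1 + `|h| by have := normr_ge0 h; lra.
have s0 : 0 < s by rewrite divr_gt0 // subr_gt0.
have s1 : s <= 1 by rewrite ler_pdivrMr //; have := normr_ge0 h; lra.
have sh : s * `|h| <= r - `|v|.
  rewrite mulrAC ler_pdivrMr // ler_wpM2l ?subr_ge0 ?(ltW vr') //.
  lra.
have shn : `|v - s *: h| <= r.
  apply: le_trans (ler_normB _ _) _; rewrite normrZ gtr0_norm //; lra.
have := vmin _ shn; rewrite leNgt => /negP; apply.
rewrite /m -/w.
(* Because [P A B P = P], the linear part of the increment is [- s P w]; the other summand is the
   linearisation error. *)
have -> : P (F (x + (c + (v - s *: h))) - z) = (1 - s) *: P w +
    P (F (x + (c + (v - s *: h))) - F (x + (c + v)) -
       'd F x ((c + (v - s *: h)) - (c + v))).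
  have -> : c + (v - s *: h) - (c + v) = - (s *: h).
    by rewrite opprD addrACA subrr add0r addrAC subrr add0r.
  have -> : F (x + (c + (v - s *: h))) - z =
     F (x + (c + (v - s *: h))) - F (x + (c + v)) + w by rewrite /w [RHS]addrA subrK.
  have -> : 'd F x (- (s *: h)) = - (s *: 'd F x h) by rewrite linearN linearZ.
  have PD a a' : P (a + a') = P a + P a' by rewrite linearD.
  have PZ t a : P (t *: a) = t *: P a by rewrite linearZ.
  set D := F _ - F _; rewrite opprK (PD D w) (PD D) PZ /h PAB.
  rewrite scalerBl scale1r addrC -!addrA; congr (_ + _).
  by rewrite addrCA addNr addr0.
have rem : `|P (F (x + (c + (v - s *: h))) - F (x + (c + v)) -
       'd F x ((c + (v - s *: h)) - (c + v)))| <= 4^-1 * (s * `|P w|).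
  apply: le_trans (KPP _) _.
  apply: le_trans (_ : KP * (e * (s * (KB * `|P w|))) <= _); last first.
    by rewrite -eK le_eqVlt; apply/orP; left; apply/eqP; ring.
  rewrite ler_pM2l //; apply: le_trans (strict _ _ _ _) _.
  - exact: le_lt_trans (cv _ shn) r1.
  - exact: le_lt_trans (cv _ vr) r1.
  have -> : c + (v - s *: h) - (c + v) = - (s *: h).
    by rewrite opprD addrACA subrr add0r addrAC subrr add0r.
  by rewrite ler_pM2l // normrN normrZ gtr0_norm // ler_pM2l.
have n1 := ler_normD ((1 - s) *: P w) (P (F (x + (c + (v - s *: h))) -
  F (x + (c + v)) - 'd F x ((c + (v - s *: h)) - (c + v)))).
rewrite normrZ ger0_norm ?subr_ge0 // in n1.
have n2 : al * `|v - s *: h| <= al * `|v| + 4^-1 * (s * `|P w|).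
  apply: le_trans (_ : al * (`|v| + s * (KB * `|P w|)) <= _).
    rewrite ler_pM2l //; apply: le_trans (ler_normB _ _) _.
    by rewrite normrZ gtr0_norm // lerD2l ler_pM2l.
  by rewrite -alK mulrDr lerD2l le_eqVlt; apply/orP; left; apply/eqP; ring.
have sP : 0 < s * `|P w| by rewrite mulr_gt0.
lra.
Qed.

End Graves.

(** * Condition (a): decomposable functions *)

Lemma adjoint_exists {R : realType} {V W : fdHilbertType R} (L : {linear V -> W}) w :
  exists v, forall h, inner w (L h) = inner v h.
Proof.
have [b bP] := @parseval R V; exists (\sum_(e <- b) inner w (L e) *: e) => h.
rewrite {1}(bP h) linear_proj_seq innerC !inner_suml; apply: eq_bigr => e _.
by rewrite !innerZl mulrC (innerC (L e)) (innerC e).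
Qed.

Lemma harmonic_to_zero_pos {R : realType} :
  to_zero_pos (fun k => k.+1%:R^-1 : R).
Proof. by split=> [k|]; [rewrite invr_gt0|exact: cvg_harmonic]. Qed.

(** Dividing by [e] and letting [e] tend to [0] leaves [q - h >= 0]; the proof uses one explicit
    small [e] instead of a limit. *)
Lemma quad_limit {R : realType} (q h : R) :
  (forall e, 0 < e < 1 -> (e ^+ 2 - e) * h + e * q >= 0) -> h <= q.
Proof.
move=> E; rewrite leNgt; apply/negP => qh.
pose e := (h - q) / (2 * (1 + `|h| + `|q|)).
have D : 0 < 2 * (1 + `|h| + `|q|).
  by have := normr_ge0 h; have := normr_ge0 q; lra.
have e01 : 0 < e < 1.
  rewrite divr_gt0 ?subr_gt0 //= ltr_pdivrMr //.
  have := ler_norm h; have := ler_norm (- q); rewrite normrN.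
  by have := normr_ge0 h; have := normr_ge0 q; lra.
have e0 : 0 < e by case/andP: e01.
have := E e e01; rewrite (_ : _ + _ = e * (e * h - h + q)); last by ring.
rewrite pmulr_rge0 // => E1.
have : e * h <= (h - q) / 2.
  apply: le_trans (_ : e * (1 + `|h| + `|q|) <= _).
    rewrite ler_pM2l //; have := ler_norm h; have := normr_ge0 q; lra.
  by rewrite /e mulrAC ler_pdivrMr // le_eqVlt; apply/orP; left; apply/eqP; field.
lra.
Qed.

(** Adding the two subgradient inequalities cancels [T], the value of [theta], as its weights [e]
    and [1 - e] sum to one. Here [s] is the step; the first letters [y], [h], [b] stand for pairings
    with [y k], [yh k], [ybar], and [l] for the value of [<lam, Xi>]; the second letter is the
    direction. *)
Lemma second_difference_arith {R : realType}
    (s e T yr ya yp hp br bp ba lr lp la : R) : 0 < s ->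
  s * hp <= e * T + (lp - e * la) ->
  T + s * (yr - ya) <= (1 - e) * T + (lr - (1 - e) * la) ->
  s^-1 * (yr - br + (yp - bp) - (ya - ba)) - s^-1 * (yp - hp) <=
  (s ^+ 2)^-1 * (lr - s * br) + (s ^+ 2)^-1 * (lp - s * bp)
    - (s ^+ 2)^-1 * (la - s * ba).
Proof.
move=> s0 h1 h2; rewrite -subr_ge0.
rewrite (_ : _ - _ = (s ^+ 2)^-1 * (lr + lp - la - s * (yr - ya) - s * hp)).
  by rewrite mulr_ge0 ?invr_ge0 ?sqr_ge0 //; lra.
by field; rewrite gt_eqF.
Qed.

Section Decomposable.
Context {R : realType} {Y Z : fdHilbertType R}.
Variables (g : Y -> \bar R) (u ybar : Y) (O : set Y)
  (theta : Z -> \bar R) (Xi : Y -> Z).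
Hypotheses (decomp : C2_decomposition g u O theta Xi)
  (nondeg : nondegeneracy u theta Xi) (g_ybar : subdifferential g u ybar).

Let gu_fin : g u \is a fin_num. Proof. by case: decomp. Qed.
Let oO : open O. Proof. by case: decomp => _ []. Qed.
Let Ou : O u. Proof. by case: decomp => _ []. Qed.
Let th_proper : proper_efun theta. Proof. by case: decomp => _ _ []. Qed.
Let th_lsc : lower_semicontinuous theta. Proof. by case: decomp => _ _ []. Qed.
Let th_sub : sublinear theta. Proof. by case: decomp => _ _ []. Qed.
Let XiC2 : C2_on O Xi. Proof. by case: decomp => _ _ _ []. Qed.
Let Xiu : Xi u = 0. Proof. by case: decomp => _ _ _ []. Qed.
Let gE v : O v -> g v = (g u + theta (Xi v))%E.
Proof. by case: decomp => _ _ _ _; exact. Qed.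

Let C1Xi : C1_on O Xi.
Proof.
split=> [x Ox|h x Ox]; first by case: XiC2 => + _; apply.
by apply: differentiable_continuous; case: XiC2 => _ /(_ h)[+ _]; apply.
Qed.

(* [P] plays the orthogonal projection onto [par C], and [B] a right inverse of
   [P] composed with the differential of [Xi] at [u]. *)
Variables (P : {linear Z -> Z}) (B : {linear Z -> Y}) (d0 K0 : R).
Let A := 'd Xi u.
Hypotheses
  (PN : forall n, P n = 0 -> forall c c', subdifferential theta 0 c ->
     subdifferential theta 0 c' -> inner (c - c') n = 0)
  (PAB : forall z, P (A (B (P z))) = P z)
  (d00 : 0 < d0) (K00 : 0 < K0)
  (gravesP : forall c z, `|c| <= d0 -> `|Xi (u + c) - z| <= d0 ->
    exists2 v, `|v| <= K0 * `|Xi (u + c) - z| & P (Xi (u + (c + v)) - z) = 0).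

Section Rays.
Variable t : nat -> R.
Hypothesis tz : to_zero_pos t.

Let t0 k : 0 < t k. Proof. by case: tz. Qed.

Lemma cvg_scaled_residual (a : nat -> Y) (a0 : Y) : a @ \oo --> a0 ->
  (fun k => (t k ^+ 2)^-1 *: (Xi (u + t k *: a k) - t k *: A (a k))) @ \oo -->
  2^-1 *: second_diff Xi u a0 a0.
Proof.
move=> aa; have := taylor2_seq oO Ou XiC2 tz aa; rewrite Xiu.
by under eq_fun do rewrite subr0.
Qed.

Lemma eventually_O (a : nat -> Y) (a0 : Y) : a @ \oo --> a0 ->
  \forall k \near \oo, O (u + t k *: a k).
Proof.
move=> aa; have : (fun k => u + t k *: a k) @ \oo --> u.
  rewrite -[X in _ --> X]addr0 -(scale0r a0); apply: cvgD; first exact: cvg_cst.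
  by apply: cvgZ => //; case: tz.
by apply; exact: open_nbhs_nbhs.
Qed.

Lemma cvg_perturbation (a b : nat -> Y) (a0 : Y) (M : R) : a @ \oo --> a0 ->
  (\forall k \near \oo, `|b k - a k| <= M * t k) -> b @ \oo --> a0.
Proof.
move=> aa bM; apply: cvg_sub0 aa.
have Mt : (fun k => M * t k) @ \oo --> (0 : R).
  by rewrite -(mulr0 M); apply: cvgM; [exact: cvg_cst|case: tz].
apply/cvgr0Pnorm_le => e e0; near=> k.
apply: (@le_trans _ _ (M * t k)); first by near: k.
by near: k; apply: (cvgr_le 0 Mt).
Unshelve. all: by end_near. Qed.

(** The assumed limit makes [Xi (u + t a) - z] of order [t^2]. The Graves estimate removes its [P]
    part by a displacement of the same order, which is a change of order [t] in the direction. *)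
Lemma correction (a : nat -> Y) (a0 : Y) (z : nat -> Z) (l : Z) : a @ \oo --> a0 ->
  (fun k => (t k ^+ 2)^-1 *: (Xi (u + t k *: a k) - z k)) @ \oo --> (l : Z) ->
  exists (b : nat -> Y) (M : R),
    (\forall k \near \oo, `|b k - a k| <= M * t k) /\
    (\forall k \near \oo, P (Xi (u + t k *: b k) - z k) = 0).
Proof.
move=> aa zl; pose M := K0 * (`|l| + 1).
have zl1 : \forall k \near \oo,
    `|(t k ^+ 2)^-1 *: (Xi (u + t k *: a k) - z k)| <= `|l| + 1.
  by apply: (@cvgr_le _ _ _ _ _ `|l|); [exact: cvg_norm|rewrite ltrDl].
have ta0 : (fun k => t k *: a k) @ \oo --> (0 : Y).
  by rewrite -(scale0r a0); apply: cvgZ => //; case: tz.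
have t20 : (fun k => t k ^+ 2) @ \oo --> (0 : R).
  under eq_fun do rewrite expr2.
  by rewrite -(mulr0 (0 : R)); apply: cvgM; case: tz.
have small1 : \forall k \near \oo, `|t k *: a k| <= d0.
  by apply: cvgr0_norm_le.
have small2 : \forall k \near \oo,
    `|Xi (u + t k *: a k) - z k| <= t k ^+ 2 * (`|l| + 1).
  apply: filterS zl1 => k; rewrite normrZ gtr0_norm ?invr_gt0 ?exprn_gt0 //.
  by rewrite mulrC ler_pdivrMr ?exprn_gt0 // mulrC.
have small3 : \forall k \near \oo, t k ^+ 2 * (`|l| + 1) <= d0.
  have : (fun k => t k ^+ 2 * (`|l| + 1)) @ \oo --> (0 : R).
    by rewrite -(mul0r (`|l| + 1)); apply: cvgM => //; exact: cvg_cst.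
  by move=> h; apply: (cvgr_le 0 h).
pose Q k b := `|b - a k| <= M * t k /\ P (Xi (u + t k *: b) - z k) = 0.
have ex : \forall k \near \oo, exists b, Q k b.
  near=> k.
  have s1 : `|t k *: a k| <= d0 by near: k.
  have s2 : `|Xi (u + t k *: a k) - z k| <= t k ^+ 2 * (`|l| + 1) by near: k.
  have s3 : t k ^+ 2 * (`|l| + 1) <= d0 by near: k.
  have [v vK vP] := gravesP s1 (le_trans s2 s3).
  exists (a k + (t k)^-1 *: v); split.
    rewrite addrAC subrr add0r normrZ gtr0_norm ?invr_gt0 // mulrC ler_pdivrMr //.
    have -> : M * t k * t k = K0 * (t k ^+ 2 * (`|l| + 1)) by rewrite /M; ring.
    by apply: le_trans vK _; rewrite ler_pM2l.
  by rewrite scalerDr scalerA mulfV ?scale1r // gt_eqF.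
(* At the finitely many indices without a correction, [b k] is arbitrary. *)
have /choice[b bP] : forall k, exists b, (exists b', Q k b') -> Q k b.
  move=> k; have [[b Qb]|nQ] := pselect (exists b, Q k b).
    by exists b.
  by exists 0.
exists b, M; split; apply: filterS ex => k /bP[] //.
Unshelve. all: by end_near. Qed.

End Rays.

(** If the subdifferential were empty, so would be its affine hull and [par], whereas nondegeneracy
    puts [0] in [par]. *)
Lemma subdifferential_neq0 : exists c, subdifferential theta 0 c.
Proof.
have [[a Ca _] _] : (par (subdifferential theta (Xi u)) `&`
    [set z | adjoint ('d Xi u) z = 0]) 0 by rewrite nondeg.
rewrite Xiu in Ca; apply: contrapT => nC; apply: (Ca set0).
by split=> [x y s []|c Cc]; apply: nC; exists c.
Qed.

Lemma theta_translate c0 n : subdifferential theta 0 c0 -> P n = 0 ->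
  forall z, theta (z + n) = (theta z + (inner c0 n)%:E)%E.
Proof.
move=> c0C Pn; apply: sublinear_translate => // c cC.
by apply/eqP; rewrite -subr_eq0 -innerBl; apply/eqP; exact: PN.
Qed.

(** First-order growth of [g] along [v]: after correction [Xi] follows [t A v] up to a vector killed
    by [P], on which [theta] acts linearly and which is [o(t)]. The subgradient inequality is
    divided by [t]. *)
Lemma subgradient_le_theta v : ((inner ybar v)%:E <= theta (A v))%E.
Proof.
have [c0 c0C] := subdifferential_neq0.
pose t k : R := k.+1%:R^-1; have tz : to_zero_pos t by exact: harmonic_to_zero_pos.
have t0 k : 0 < t k by case: tz.
have vv : (fun _ : nat => v) @ \oo --> v by exact: cvg_cst.
have [b [M [bM bP]]] := correction tz vv (cvg_scaled_residual tz vv).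
have bv := cvg_perturbation tz vv bM.
have bO := eventually_O tz bv.
case tA : (theta (A v)) => [r| |];
  [|by rewrite leey|by have := th_proper.1 (A v); rewrite tA].
rewrite lee_fin.
have H : \forall k \near \oo, inner ybar (b k) <= r +
    inner c0 ((t k)^-1 *: (Xi (u + t k *: b k) - t k *: A v)).
  near=> k.
  have Ob : O (u + t k *: b k) by near: k.
  have Pb : P (Xi (u + t k *: b k) - t k *: A v) = 0 by near: k.
  have [_ /(_ (u + t k *: b k))] := g_ybar.
  have [_ tZ _] := th_sub.
  rewrite (gE Ob) -{1}(subrK (t k *: A v) (Xi _)) [X in theta X]addrC.
  rewrite (theta_translate c0C Pb) tZ // tA -(fineK gu_fin) -EFinM -!EFinD lee_fin.
  rewrite lerD2l (addrC u) addrK innerZr innerZr => H.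
  by rewrite -(ler_pM2l (t0 k)) mulrDr mulrA mulfV ?mul1r // gt_eqF.
have L : (fun k => r + inner c0 ((t k)^-1 *: (Xi (u + t k *: b k) - t k *: A v)))
    @ \oo --> r + inner c0 (A v - A v).
  apply: cvgD; first exact: cvg_cst.
  apply: cvg_inner; first exact: cvg_cst.
  have -> : (fun k => (t k)^-1 *: (Xi (u + t k *: b k) - t k *: A v)) =
     (fun k => (t k)^-1 *: (Xi (u + t k *: b k) - Xi u) - A v).
    by apply/funext => k; rewrite Xiu subr0 scalerBr scalerA mulVf ?scale1r // gt_eqF.
  apply: cvgB; last exact: cvg_cst.
  by apply: differentiable_seq => //; exact: C1Xi.1.
rewrite -[r]addr0 -(inner0r c0) -(subrr (A v)).
apply: ler_cvg_to L H; apply: cvg_inner => //; exact: cvg_cst.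
Unshelve. all: by end_near. Qed.

(** The chain rule for subgradients at [u]: [ybar] is the adjoint image of some [lam] in the
    subdifferential of [theta] at [0]. *)
Lemma multiplier_exists : exists2 lam, subdifferential theta 0 lam &
  forall v, inner lam (A v) = inner ybar v.
Proof.
have [c0 c0C] := subdifferential_neq0.
have [a1 a1P] := adjoint_exists B ybar; have [a2 a2P] := adjoint_exists P a1.
have [b1 b1P] := adjoint_exists A c0; have [b2 b2P] := adjoint_exists B b1.
have [b3 b3P] := adjoint_exists P b2.
(* [lam] pairs [P z] as [ybar] does through [B], and pairs the remainder [z - A (B (P z))], killed
   by [P], as [c0] does. *)
pose lam := a2 + c0 - b3.
have lamE z : inner lam z = inner ybar (B (P z)) + inner c0 (z - A (B (P z))).
  by rewrite innerBl innerDl -a2P -a1P -b3P -b2P -b1P innerBr addrA.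
have ker z : P (z - A (B (P z))) = 0 by rewrite linearB PAB subrr.
have [t00 _ _] := th_sub; have th0 := sublinear0 th_proper th_sub.
exists lam => [|v].
  split=> [|z]; rewrite th0 // add0e subr0 lamE EFinD.
  have -> : theta z = theta (A (B (P z)) + (z - A (B (P z)))) by rewrite addrC subrK.
  rewrite (theta_translate c0C (ker z)).
  by rewrite leeD2r // subgradient_le_theta.
rewrite lamE; set v' := v - B (P (A v)).
have v'E : A v - A (B (P (A v))) = A v' by rewrite linearB.
have Pv' : P (A v') = 0 by rewrite -v'E ker.
have PNv' : P (A (- v')) = 0 by rewrite !linearN Pv' oppr0.
(* On [A v'] and its opposite [theta] is the linear form [c0], so the bounds for [v'] and [- v']
   combine into an equality. *)
have le1 : inner ybar v' <= inner c0 (A v').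
  have := subgradient_le_theta v'; rewrite -[X in theta X]add0r.
  rewrite (theta_translate c0C Pv') th0.
  by rewrite add0e lee_fin.
have le2 : inner ybar (- v') <= inner c0 (A (- v')).
  have := subgradient_le_theta (- v'); rewrite -[X in theta X]add0r.
  by rewrite (theta_translate c0C PNv') th0 add0e lee_fin.
have -> : inner c0 (A v - A (B (P (A v)))) = inner ybar v'.
  rewrite v'E; move: le2; rewrite linearN !innerNr; lra.
by rewrite /v' innerBr addrC subrK.
Qed.

Section SecondOrder.
Variable lam : Z.
Hypotheses (lamC : subdifferential theta 0 lam)
  (lamA : forall v, inner lam (A v) = inner ybar v).

Let H v := inner lam (second_diff Xi u v v).

Lemma cvg_multiplier_quotient (t : nat -> R) (a : nat -> Y) (a0 : Y) :
  to_zero_pos t -> a @ \oo --> a0 ->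
  (fun k => (t k ^+ 2)^-1 * (inner lam (Xi (u + t k *: a k)) - t k * inner ybar (a k)))
    @ \oo --> 2^-1 * H a0.
Proof.
move=> tz aa; rewrite /H -innerZr.
under eq_fun do rewrite -lamA -innerZr -innerBr -innerZr.
by apply: cvg_inner; [exact: cvg_cst|exact: cvg_scaled_residual].
Qed.

Lemma value_corrected v z : O v -> P (Xi v - z) = 0 ->
  g v = (g u + (theta z + (inner lam (Xi v - z))%:E))%E.
Proof.
by move=> Ov Pz; rewrite gE // -(theta_translate lamC Pz) (addrC z) subrK.
Qed.

(** In turn: the curvature [H w] is at most [<eta, w>]; [theta (A w)] equals [<lam, A w>]; along a
    corrected ray the second-order quotients of [g] tend to [H w]. *)
Lemma semistrict_decomposable w eta :
  semistrict_derivative (subdifferential g) u ybar w eta ->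
  (second_subderivative g u ybar w <= (inner eta w)%:E)%E.
Proof.
move=> [t [x [y [yh [tz [xu yy yhy] sub ww ee]]]]].
have t0 k : 0 < t k by case: tz.
have [a aE] : exists a : nat -> Y, a = (fun k => (t k)^-1 *: (x k - u)).
  by eexists.
rewrite -aE in ww.
have xE k : x k = u + t k *: a k.
  by rewrite aE scalerA mulfV ?scale1r ?gt_eqF // addrC subrK.
have [_ tZ tD] := th_sub.
have aO := eventually_O tz ww.
have [T TP] : exists T : nat -> R, \forall k \near \oo, theta (Xi (x k)) = (T k)%:E.
  exists (fun k => fine (theta (Xi (x k)))); near=> k; rewrite fineK //.
  have [gf _] := (sub k).1; move: gf; rewrite xE gE; last by near: k.
  by rewrite -(fineK gu_fin) fin_numD => /andP[].
(* [s = e] and [s = 1 - e] split the value [theta (Xi (x k))] additively,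
   because [theta] is positively homogeneous. *)
have scaled s : exists (b : nat -> Y) (M : R),
    [/\ \forall k \near \oo, `|b k - s *: a k| <= M * t k,
        \forall k \near \oo, P (Xi (u + t k *: b k) - s *: Xi (x k)) = 0 &
        b @ \oo --> s *: w].
  have sa : (fun k => s *: a k) @ \oo --> s *: w.
    by apply: cvgZ; [exact: cvg_cst|].
  have [|b [M [bM bP]]] := @correction t tz _ _ (fun k => s *: Xi (x k))
     (2^-1 *: second_diff Xi u (s *: w) (s *: w) -
      s *: (2^-1 *: second_diff Xi u w w)) sa.
    have -> : (fun k => (t k ^+ 2)^-1 *: (Xi (u + t k *: (s *: a k)) - s *: Xi (x k))) =
        (fun k => (t k ^+ 2)^-1 *: (Xi (u + t k *: (s *: a k)) - t k *: A (s *: a k)))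
        - (fun k => s *: ((t k ^+ 2)^-1 *: (Xi (u + t k *: a k) - t k *: A (a k)))).
      apply/funext => k; rewrite !fctE -xE [s *: (_ *: _)]scalerA [s * _]mulrC -scalerA.
      rewrite -scalerBr; congr (_ *: _).
      have -> : A (s *: a k) = s *: A (a k) by rewrite linearZ.
      by rewrite scalerBr !scalerA [s * t k]mulrC opprB addrA subrK.
    apply: cvgB; first exact: cvg_scaled_residual.
    by apply: cvgZ; [exact: cvg_cst|exact: cvg_scaled_residual].
  have bw := cvg_perturbation tz sa bM.
  by exists b, M; split.
have Hw : H w <= inner eta w.
  apply: quad_limit => e /andP[e0 e1].
  have [p [Mp [pM pP pw]]] := scaled e.
  have [r [Mr [rM rP rw]]] := scaled (1 - e).
  have pO := eventually_O tz pw; have rO := eventually_O tz rw.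
  pose E b k := (t k ^+ 2)^-1 *
    (inner lam (Xi (u + t k *: b k)) - t k * inner ybar (b k)).
  have L1 : (fun k => E r k + E p k - E a k) @ \oo -->
      2^-1 * H ((1 - e) *: w) + 2^-1 * H (e *: w) - 2^-1 * H w.
    by apply: cvgB; [apply: cvgD|]; apply: cvg_multiplier_quotient.
  (* The first term vanishes in the limit: [r + p - a] is of order [t], since the weights [1 - e]
     and [e] sum to one, and [y] tends to [ybar]. *)
  have L2 : (fun k => inner (y k - ybar) ((t k)^-1 *: (r k + p k - a k)) -
      inner ((t k)^-1 *: (y k - yh k)) (p k)) @ \oo --> 0 - inner eta (e *: w).
    apply: cvgB; last exact: cvg_inner.
    apply/cvgr0Pnorm_le => d d_gt0.
    pose M := `|Mr| + `|Mp| + 1.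
    have M0 : 0 < M by rewrite ltr_wpDl // addr_ge0.
    have yd : \forall k \near \oo, `|y k - ybar| <= d / M.
      have : (fun k => y k - ybar) @ \oo --> (0 : Y).
        by rewrite -(subrr ybar); apply: cvgB => //; exact: cvg_cst.
      by move=> /cvgr0_norm_le; apply; rewrite divr_gt0.
    near=> k; apply: le_trans (cauchy_schwarz _ _) _.
    have -> : d = d / M * M by rewrite divfK // gt_eqF.
    apply: ler_pM => //; first by near: k.
    rewrite normrZ gtr0_norm ?invr_gt0 // mulrC ler_pdivrMr //.
    have -> : r k + p k - a k = (r k - (1 - e) *: a k) + (p k - e *: a k).
      by rewrite addrACA -opprD -scalerDl subrK scale1r.
    apply: le_trans (ler_normD _ _) _.
    have h1 : `|r k - (1 - e) *: a k| <= Mr * t k by near: k.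
    have h2 : `|p k - e *: a k| <= Mp * t k by near: k.
    have := t0 k; have := ler_norm Mr; have := ler_norm Mp; rewrite /M; nra.
  have LE : \forall k \near \oo, inner (y k - ybar) ((t k)^-1 *: (r k + p k - a k)) -
      inner ((t k)^-1 *: (y k - yh k)) (p k) <= E r k + E p k - E a k.
    near=> k.
    have ka : O (u + t k *: a k) by near: k.
    have kp : O (u + t k *: p k) by near: k.
    have kr : O (u + t k *: r k) by near: k.
    have kT : theta (Xi (x k)) = (T k)%:E by near: k.
    have kpP : P (Xi (u + t k *: p k) - e *: Xi (x k)) = 0 by near: k.
    have krP : P (Xi (u + t k *: r k) - (1 - e) *: Xi (x k)) = 0 by near: k.
    have gx : g (x k) = (g u + (T k)%:E)%E by rewrite {1}xE (gE ka) -xE kT.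
    have [_ /(_ (u + t k *: r k))] := (sub k).1.
    have [_ /(_ (u + t k *: p k))] := (sub k).2.
    rewrite (value_corrected kp kpP) (value_corrected kr krP) !tZ ?subr_gt0 //.
    rewrite gx kT -(fineK gu_fin) -!EFinM -!EFinD !lee_fin.
    have -> : u + t k *: p k - u = t k *: p k by rewrite (addrC u) addrK.
    have -> : u + t k *: r k - x k = t k *: (r k - a k).
      by rewrite xE opprD addrACA subrr add0r scalerBr.
    rewrite !innerZr !innerBr !innerZr !lerD2l -!addrA !lerD2l !addrA /E -xE => h1 h2.
    rewrite innerZl !(innerBl, innerDr, innerBr).
    by apply: (@second_difference_arith _ _ e (T k)) => //; lra.
  have HZ s : H (s *: w) = s ^+ 2 * H w.
    by rewrite /H (second_diffZl Ou XiC2) second_diffZr !innerZr mulrA -expr2.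
  have : 0 - inner eta (e *: w) <=
      2^-1 * H ((1 - e) *: w) + 2^-1 * H (e *: w) - 2^-1 * H w.
    exact: ler_cvg_to L2 L1 LE.
  rewrite !HZ innerZr; lra.
(* For the upper bound, the subgradient [y k] tested at [u] gives [T k <= t k <y k, a k>], and
   [T k / t k] is the value of [theta] at points tending to [A w]. *)
have thA : theta (A w) = (inner lam (A w))%:E.
  apply/eqP; rewrite eq_le; apply/andP; split; last first.
    by have [_ /(_ (A w))] := lamC; rewrite subr0 (sublinear0 th_proper th_sub) add0e.
  rewrite leNgt lamA; apply/negP => /ereal_between[r wr] /th_lsc[N NA rN].
  have Xa : (fun k => (t k)^-1 *: (Xi (u + t k *: a k) - Xi u)) @ \oo --> A w.
    by apply: differentiable_seq => //; exact: C1Xi.1.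
  have ya : \forall k \near \oo, inner (y k) (a k) < r.
    by apply: (cvgr_lt (inner ybar w)) => //; exact: cvg_inner.
  have XN : \forall k \near \oo, N ((t k)^-1 *: (Xi (u + t k *: a k) - Xi u)).
    exact: Xa.
  have : \forall k \near \oo, False.
    near=> k.
    have ka : O (u + t k *: a k) by near: k.
    have kT : theta (Xi (x k)) = (T k)%:E by near: k.
    have kN : N ((t k)^-1 *: (Xi (u + t k *: a k) - Xi u)) by near: k.
    have ky : inner (y k) (a k) < r by near: k.
    have gx : g (x k) = (g u + (T k)%:E)%E by rewrite {1}xE (gE ka) -xE kT.
    have [_ /(_ u)] := (sub k).1; rewrite gx -(fineK gu_fin) -!EFinD lee_fin.
    have -> : u - x k = - (t k *: a k) by rewrite xE opprD addrA subrr add0r.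
    rewrite innerNr innerZr => h1.
    have := rN _ kN; rewrite Xiu subr0 tZ ?invr_gt0 // -xE kT -EFinM lte_fin.
    rewrite mulrC ltr_pdivlMr // => h2.
    have : inner (y k) (a k) * t k < r * t k by rewrite ltr_pM2r.
    lra.
  by move=> /filter_ex[].
have w_cst : (fun _ : nat => w) @ \oo --> w by exact: cvg_cst.
(* On this ray [Xi] follows [t A w] up to the kernel of [P], so that [g - g u] equals [<lam, Xi>]
   there. *)
have [b [M [bM bP]]] := correction tz w_cst (cvg_scaled_residual tz w_cst).
have bw := cvg_perturbation tz w_cst bM.
have bO := eventually_O tz bw.
apply: le_trans (_ : (H w)%:E <= _)%E; last by rewrite lee_fin.
have L := cvg_multiplier_quotient tz bw.
rewrite (_ : H w = 2 * (2^-1 * H w)); last by field.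
have cst2 : (fun _ : nat => 2 : R) @ \oo --> (2 : R) by exact: cvg_cst.
apply: (limf_einf_le_seq tz bw _ (cvgM cst2 L)).
near=> k.
have kb : O (u + t k *: b k) by near: k.
have kbP : P (Xi (u + t k *: b k) - t k *: A w) = 0 by near: k.
rewrite /= /diff_quotient2 (value_corrected kb kbP) tZ // thA -(fineK gu_fin).
rewrite -EFinM lee_fin innerBr innerZr.
rewrite le_eqVlt; apply/orP; left; apply/eqP; field; rewrite gt_eqF //.
Unshelve. all: by end_near. Qed.

End SecondOrder.
End Decomposable.

(** * The second-order bound under (a) and under (b) *)

Section SecondOrderBound.
Context {R : realType} {Y : fdHilbertType R}.
Implicit Types (g : Y -> \bar R) (u ybar w eta : Y).

Lemma semistrict_second_order_decomposable {Z : fdHilbertType R} g u ybar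
    (O : set Y) (theta : Z -> \bar R) (Xi : Y -> Z) w eta :
  C2_decomposition g u O theta Xi -> nondegeneracy u theta Xi ->
  subdifferential g u ybar ->
  semistrict_derivative (subdifferential g) u ybar w eta ->
  (second_subderivative g u ybar w <= (inner eta w)%:E)%E.
Proof.
move=> dec nd gy; have [P [B [PN PAB]]] := nondegenerate_right_inverse nd.
have [_ [oO Ou] _ [XiC2 Xiu] _] := dec; rewrite Xiu in PN.
have C1Xi : C1_on O Xi.
  split=> [x Ox|h x Ox]; first by case: XiC2 => + _; apply.
  by apply: differentiable_continuous; case: XiC2 => _ /(_ h)[+ _]; apply.
have [d [K [d0 K0 gr]]] := graves oO Ou C1Xi PAB.
have [lam lamC lamA] := multiplier_exists dec nd gy PN PAB d0 K0 gr.
exact: (semistrict_decomposable dec PN d0 K0 gr lamC lamA).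
Qed.

(** The subgradient [ybar] bounds the difference quotients from below near [w]; the subgradients
    [y k] tested at [u] bound them from above along [a] by [<y k, a k>]. For the indicator of
    [Theta] the same argument treats normal vectors. *)
Lemma subgradient_critical g u ybar w (t : nat -> R) (a y : nat -> Y) :
  subdifferential g u ybar -> to_zero_pos t -> a @ \oo --> w ->
  y @ \oo --> ybar -> (forall k, subdifferential g (u + t k *: a k) (y k)) ->
  critical_cone g u ybar w.
Proof.
move=> gy tz aw yy sub; have [b [gu bP]] := subdifferential_fin gy.
apply/eqP; rewrite eq_le; apply/andP; split.
  apply/lee_addgt0Pr => e e0; rewrite -leeBlDr // -EFinB.
  apply: limf_einf_ge_near.
  have wb : \forall v \near w, inner ybar w - e < inner ybar v.
    apply: (cvgr_gt (inner ybar w)); last by rewrite ltrBlDr ltrDl.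
    by apply: cvg_inner; [exact: cvg_cst|exact: cvg_id].
  exists ([set s : R | 0 < s], [set v | inner ybar w - e < inner ybar v]).
    by split => //=; exact: nbhs_right_gt.
  move=> [s v] [/= s0 sv]; apply: le_trans (_ : (inner ybar v)%:E <= _)%E.
    by rewrite lee_fin ltW.
  have := bP (u + s *: v); rewrite (addrC u) addrK innerZr gu.
  case: (g _) => [c| |] //; last by rewrite addye // mulyr gtr0_sg ?invr_gt0 // mul1e !leey.
  rewrite lee_fin => h; rewrite -EFinB -EFinM lee_fin ler_pdivlMr // mulrC; lra.
have ya : (fun k => inner (y k) (a k)) @ \oo --> inner ybar w by exact: cvg_inner.
apply: (limf_einf_le_seq tz aw _ ya); apply: nearW => k /=.
have t0 : 0 < t k by case: tz.
have [c [gc cP]] := subdifferential_fin (sub k).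
have := cP u; rewrite gc gu lee_fin => h.
rewrite -EFinB -EFinM lee_fin ler_pdivrMr // mulrC.
move: h; rewrite opprD addrA subrr add0r innerNr innerZr; lra.
Qed.

Lemma indicator_subdifferential (C : set Y) x v :
  normal_cone C x v -> subdifferential (indicator C) x v.
Proof.
move=> [Cx vP]; rewrite /subdifferential /indicator /=.
rewrite (mem_set Cx); split=> // z.
by case: ifPn => [/set_mem Cz|_]; rewrite ?leey // add0e lee_fin vP.
Qed.

(** The subgradient at [u + t a] is tested at a recovery point for the step [(1 - s) t]. The
    quotients at both steps are then close to the same value [dl], and small [s] gives the sharp
    constant. *)
Lemma second_subderivative_le_graphical g u ybar w d :
  subdifferential g u ybar -> twice_epi_differentiable g u ybar ->
  graphical_derivative (subdifferential g) u ybar w d ->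
  (second_subderivative g u ybar w <= (inner d w)%:E)%E.
Proof.
move=> gy epi [t [p [tz pw sub]]].
have [b [gu bP]] := subdifferential_fin gy.
pose a k := (p k).1; pose e k := (p k).2.
have aw : a @ \oo --> w by exact: (cvg_comp _ _ pw cvg_fst).
have ed : e @ \oo --> d by exact: (cvg_comp _ _ pw cvg_snd).
have t0 k : 0 < t k by case: tz.
have /choice[c cP] : forall k, exists c : R, g (u + t k *: a k) = c%:E /\
    forall z, ((c + inner (ybar + t k *: e k) (z - (u + t k *: a k)))%:E <= g z)%E.
  by move=> k; exact: subdifferential_fin (sub k).
have dqE k : diff_quotient2 g u ybar (t k) (a k) =
    ((c k - b - t k * inner ybar (a k)) / (2^-1 * t k ^+ 2))%:E.
  by rewrite /diff_quotient2 (cP k).1 gu.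
set D := second_subderivative _ _ _ _.
have D0 : (0 <= D)%E.
  apply: limf_einf_ge_near.
  exists ([set s : R | 0 < s], setT).
    by split => /=; [exact: nbhs_right_gt|exact: filterT].
  move=> [s v] [/= s0 _].
  have := bP (u + s *: v); rewrite /diff_quotient2 (addrC u) addrK innerZr gu.
  have s2 : 0 < 2^-1 * s ^+ 2 by rewrite mulr_gt0 ?exprn_gt0.
  case: (g _) => [r| |] //.
    rewrite lee_fin => h; rewrite -EFinM lee_fin divr_ge0 ?(ltW s2) //.
    lra.
  by rewrite !addye // mulyr gtr0_sg ?invr_gt0 // mul1e !leey.
(* Testing at [u] alone loses a factor [2] but shows that [D] is finite. *)
have Dfin : (D <= (2 * inner d w)%:E)%E.
  have L : (fun k => 2 * inner (e k) (a k)) @ \oo --> 2 * inner d w.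
    by apply: cvgM; [exact: cvg_cst|exact: cvg_inner].
  apply: (limf_einf_le_seq tz aw _ L); apply: nearW => k /=.
  rewrite dqE lee_fin ler_pdivrMr ?mulr_gt0 ?exprn_gt0 //.
  have := (cP k).2 u; rewrite gu lee_fin opprD addrA subrr add0r innerNr innerZr.
  rewrite innerDl innerZl; lra.
have [dl DE] : exists dl : R, D = dl%:E.
  by move: D0 Dfin; case: (D) => [r| |] // _ _; exists r.
rewrite DE lee_fin; rewrite DE lee_fin in D0.
apply: quad_limit => s /andP[s0 s1].
have l0 : 0 < 1 - s by rewrite subr_gt0.
have [z [zw zD]] := epi w (fun k => (1 - s) * t k)
  ltac:(by split=> [k|]; [rewrite mulr_gt0|rewrite -(mulr0 (1 - s));
    apply: cvgM; [exact: cvg_cst|case: tz]]).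
rewrite -/D DE in zD.
(* The comparison yields the coefficient [s^2 / 2 - s]; as [dl >= 0], it may be raised to the
   [s^2 - s] of [quad_limit]. *)
apply: (@le_trans _ _ (s * inner d w + 2^-1 * ((1 - s) ^+ 2 - 1) * dl)); last first.
  have : 0 <= s ^+ 2 * dl by rewrite mulr_ge0 ?sqr_ge0.
  lra.
apply/ler_addgt0Pr => r r0.
have L : (fun k => inner (e k) ((1 - s) *: z k - a k)) @ \oo -->
    inner d ((1 - s) *: w - w).
  by apply: cvg_inner => //; apply: cvgB => //; apply: cvgZ => //; exact: cvg_cst.
suff : inner d ((1 - s) *: w - w) <=
    2^-1 * (1 - s) ^+ 2 * (dl + r) - 2^-1 * (dl - r).
  have : 0 <= (s * (2 - s)) * r by rewrite !mulr_ge0 ?ltW // subr_gt0; lra.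
  rewrite innerBr innerZr; lra.
apply: cvgr_to_le L _.
have near1 : \forall k \near \oo,
    ((dl - r)%:E < diff_quotient2 g u ybar (t k) (a k))%E.
  apply: (lt_limf_einf_seq (f := fun p => diff_quotient2 g u ybar p.1 p.2) tz aw).
  by rewrite -/(second_subderivative g u ybar w) -/D DE lte_fin ltrBlDr ltrDl.
have near2 : \forall k \near \oo,
    (diff_quotient2 g u ybar ((1 - s) * t k) (z k) < (dl + r)%:E)%E.
  apply: (zD [set y | (y < (dl + r)%:E)%E]).
  by apply: open_ereal_lt'; rewrite lte_fin ltrDl.
near=> k.
have k1 : ((dl - r)%:E < diff_quotient2 g u ybar (t k) (a k))%E by near: k.
have k2 : (diff_quotient2 g u ybar ((1 - s) * t k) (z k) < (dl + r)%:E)%E by near: k.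
have lt0 : 0 < (1 - s) * t k by rewrite mulr_gt0.
have t2 : 0 < 2^-1 * t k ^+ 2 by rewrite mulr_gt0 ?exprn_gt0.
have lt2 : 0 < 2^-1 * ((1 - s) * t k) ^+ 2 by rewrite mulr_gt0 ?exprn_gt0.
move: k1; rewrite dqE lte_fin ltr_pdivlMr // => k1.
have := (cP k).2 (u + ((1 - s) * t k) *: z k).
move: k2; rewrite /diff_quotient2 gu.
case: (g _) => [m| |] //; last first.
  by rewrite !addye // mulyr gtr0_sg ?invr_gt0 // mul1e.
rewrite -EFinM lte_fin lee_fin ltr_pdivrMr // => k2.
have -> : u + (1 - s) * t k *: z k - (u + t k *: a k) =
    t k *: ((1 - s) *: z k - a k).
  by rewrite opprD addrACA subrr add0r scalerBr scalerA (mulrC (t k)).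
rewrite innerDl innerZl !innerZr => k3.
have tt : 0 < t k ^+ 2 by rewrite exprn_gt0.
rewrite -(ler_pM2l tt).
have E1 : inner ybar ((1 - s) *: z k - a k) =
  (1 - s) * inner ybar (z k) - inner ybar (a k) by rewrite innerBr innerZr.
rewrite E1 in k3; rewrite expr2; move: k1 k2 k3; rewrite !expr2; lra.
Unshelve. all: by end_near. Qed.

(** [w] is critical, so [<k, w> <= 0] for [k] in the polar cone and subtracting [k] can only
    increase the pairing with [w]. Approximation handles the closure. *)
Lemma semistrict_second_order_epi g u ybar w eta :
  subdifferential g u ybar -> twice_epi_differentiable g u ybar ->
  semistrict_derivative (subdifferential g) u ybar w =
    closure [set d - k | d in graphical_derivative (subdifferential g) u ybar w
                       & k in polar_cone (critical_cone g u ybar)] ->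
  semistrict_derivative (subdifferential g) u ybar w eta ->
  (second_subderivative g u ybar w <= (inner eta w)%:E)%E.
Proof.
move=> gy epi E sd.
have wK : critical_cone g u ybar w.
  case: (sd) => [t [x [y [yh [tz [xu yy yhy] sub ww ee]]]]].
  apply: (subgradient_critical gy tz ww yy) => k.
  rewrite scalerA mulfV ?scale1r ?gt_eqF //; last by case: tz.
  by rewrite addrC subrK; exact: (sub k).1.
rewrite E in sd; apply/lee_addgt0Pr => e e0.
have etaB : nbhs eta [set v | inner v w < inner eta w + e].
  apply: (cvgr_lt (inner eta w)); last by rewrite ltrDl.
  by apply: cvg_inner; [exact: cvg_id|exact: cvg_cst].
have [_ [[d dG [k kK <-]] /= de]] := sd _ etaB.
apply: le_trans (second_subderivative_le_graphical gy epi dG) _.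
rewrite -EFinD lee_fin; move: de; rewrite innerBl; have := kK _ wK; lra.
Qed.

End SecondOrderBound.

(** * The gradient of the Lagrangian *)

Section InnerLinear.
Context {R : realType} {V : fdHilbertType R}.
Variable y : V.

Lemma inner_is_linear : linear_for *:%R (inner y : V -> R).
Proof. by move=> a u v; rewrite innerDr innerZr. Qed.

HB.instance Definition _ := GRing.isLinear.Build R V R *:%R (inner y : V -> R)
  inner_is_linear.

Lemma gradientP (f : V -> R) x h : inner (gradient f x) h = 'd f x h.
Proof. by have /getPex H := riesz ('d f x); rewrite /gradient -H. Qed.

End InnerLinear.

Lemma lipschitz_arith {R : realType} (D1 I2 I3 K1 K2 K3 B xn yn v : R) :
  0 <= K1 -> 0 <= K2 -> 0 <= K3 -> 0 <= B -> 0 <= xn -> 0 <= yn -> 0 <= v ->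
  D1 <= K1 * xn * v -> I2 <= B * (K2 * xn * v) -> I3 <= yn * (K3 * v) ->
  D1 + I2 + I3 <= (K1 + B * K2 + K3) * (xn + yn) * v.
Proof.
move=> *.
have p1 : 0 <= K1 * yn * v by rewrite !mulr_ge0.
have p2 : 0 <= B * K2 * yn * v by rewrite !mulr_ge0.
have p3 : 0 <= K3 * xn * v by rewrite !mulr_ge0.
lra.
Qed.

Section AbstractGradients.
Context {R : realType} {X Y : fdHilbertType R}.

Lemma inner_gradient_diff (G1 G2 a : X) (y y' u v : Y) (p q : R) :
  inner G1 a = p + inner y u -> inner G2 a = q + inner y' v ->
  inner (G1 - G2) a = (p - q) + inner y (u - v) + inner (y - y') v.
Proof. by move=> h1 h2; rewrite innerBl h1 h2 innerBr innerBl; ring. Qed.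

(** [G1] to [G4] are the gradients of the Lagrangian at [(x, ybar)], [(xbar, ybar)], [(x, y)],
    [(xbar, yh)]. The left side equals [- <n + G4, a>], split into Hessian, mixed, multiplier and
    residual terms. *)
Lemma inner_gradient_monotone (G1 G2 G3 G4 n a : X) (ybar y yh u v : Y) (p q : R) :
  inner G1 a = p + inner ybar u -> inner G2 a = q + inner ybar v ->
  inner G3 a = p + inner y u -> inner G4 a = q + inner yh v ->
  0 <= inner (n + G4) a ->
  inner (G1 - G2) a + inner (y - ybar) (u - v) + inner (y - yh) v
    - inner (G3 + n) a <= 0.
Proof.
move=> h1 h2 h3 h4; rewrite !innerDl h4 => h5.
rewrite !(innerNl, innerDr, innerNr) h1 h2 h3; lra.
Qed.

End AbstractGradients.

Section LagrangianGradient.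
Context {R : realType} {X Y : fdHilbertType R}.
Variables (phi : X -> R) (Phi : X -> Y).
Hypotheses (phiC2 : C2_on setT phi) (PhiC2 : C2_on setT Phi).

Lemma differentiable_inner (W : fdHilbertType R) (F : W -> Y) y x :
  differentiable F x -> differentiable (fun z => inner y (F z)) x /\
  forall h, 'd (fun z => inner y (F z)) x h = inner y ('d F x h).
Proof.
move=> dF; have cy : continuous (inner y : Y -> R) by exact: linear_continuous_fd.
have dy : differentiable (inner y : Y -> R) (F x) by exact: linear_differentiable.
split; first exact: (differentiable_comp dF dy).
move=> h; have /= := diff_comp dF dy; rewrite /comp => ->.
by rewrite /= diff_lin.
Qed.

Let dphi x : differentiable phi x. Proof. exact: phiC2.1. Qed.
Let dPhi x : differentiable Phi x. Proof. exact: PhiC2.1. Qed.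

Lemma gradx_LE x y h :
  inner (gradx_L phi Phi x y) h = 'd phi x h + inner y ('d Phi x h).
Proof.
rewrite gradientP; have [d1 d2] := differentiable_inner y (dPhi x).
rewrite -d2; exact: (congr1 (fun F => F h) (diffD (dphi x) d1)).
Qed.

Lemma differentiable_gradx_L x y :
  differentiable (gradient (lagrangian phi Phi ^~ y)) x.
Proof.
have [b bP] := @parseval R X.
have -> : gradient (lagrangian phi Phi ^~ y) =
    (fun z => \sum_(e <- b) ('d phi z e + inner y ('d Phi z e)) *: e).
  apply/funext => z; rewrite [LHS]bP; apply: eq_bigr => e _.
  by rewrite -gradx_LE.
elim: b {bP} => [|e b IH].
  by under eq_fun do rewrite big_nil; exact: differentiable_cst.
under eq_fun do rewrite big_cons.
apply: differentiableD => //; apply: differentiableZl.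
have [_ /(_ e)[d1 _]] := phiC2; have [_ /(_ e)[d2 _]] := PhiC2.
apply: differentiableD; first exact: d1.
by have [] := @differentiable_inner X (fun z => 'd Phi z e) y x (d2 _ I).
Qed.

(** The difference of gradients is paired with itself. The second multiplier [y'] is unrestricted
    because the Lagrangian is affine in the multiplier and the second base point is [xbar]. *)
Lemma gradx_L_lipschitz xbar ybar : exists d C : R, [/\ 0 < d, 0 < C &
  forall x y y', `|x - xbar| < d -> `|y - ybar| < d ->
    `|gradx_L phi Phi x y - gradx_L phi Phi xbar y'| <=
      C * (`|x - xbar| + `|y - y'|)].
Proof.
have [d1 [K1 [d10 K10 P1]]] := C2_lipschitz (fun e => (phiC2.2 e).1 xbar I).
have [d2 [K2 [d20 K20 P2]]] := C2_lipschitz (fun e => (PhiC2.2 e).1 xbar I).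
have [K3 K30 P3] := linear_bound ('d Phi xbar).
have C0 : 0 < K1 + (`|ybar| + 1) * K2 + K3.
  have : 0 <= (`|ybar| + 1) * K2 by rewrite mulr_ge0 ?addr_ge0 // ltW.
  lra.
exists (Num.min 1 (Num.min d1 d2)), (K1 + (`|ybar| + 1) * K2 + K3); split=> //.
  by rewrite !lt_min ltr01 d10.
move=> x y y'; rewrite !lt_min => /and3P[_ x1 x2] /andP[y1 _].
set v := gradx_L phi Phi x y - _.
have [->|v0] := eqVneq v 0.
  by rewrite normr0 mulr_ge0 ?(ltW C0) // addr_ge0.
rewrite -(@ler_pM2r _ `|v|) ?normr_gt0 // -expr2 -innerxx.
have -> : inner v v = ('d phi x v - 'd phi xbar v)
   + inner y ('d Phi x v - 'd Phi xbar v)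
   + inner (y - y') ('d Phi xbar v).
  exact: inner_gradient_diff (gradx_LE x y v) (gradx_LE xbar y' v).
have xE : x = xbar + (x - xbar) by rewrite addrC subrK.
have e1 := P1 (x - xbar) v x1; rewrite -xE in e1.
have e2 := P2 (x - xbar) v x2; rewrite -xE in e2.
have e3 := P3 v.
have i1 := ler_norm ('d phi x v - 'd phi xbar v).
have i2 := inner_le_norm y ('d Phi x v - 'd Phi xbar v).
have i3 := inner_le_norm (y - y') ('d Phi xbar v).
have yb : `|y| <= `|ybar| + 1.
  have -> : y = ybar + (y - ybar) by rewrite addrC subrK.
  by apply: le_trans (ler_normD _ _) _; rewrite lerD2l ltW.
have j2 : `|y| * `|'d Phi x v - 'd Phi xbar v| <=
    (`|ybar| + 1) * (K2 * `|x - xbar| * `|v|) by apply: ler_pM.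
have j3 : `|y - y'| * `|'d Phi xbar v| <= `|y - y'| * (K3 * `|v|) by rewrite ler_wpM2l.
by apply: lipschitz_arith (ltW K10) (ltW K20) (ltW K30) _ _ _ _
  (le_trans i1 e1) (le_trans i2 j2) (le_trans i3 j3); rewrite ?addr_ge0.
Qed.

End LagrangianGradient.

(** * Perturbed KKT systems and calmness of the multipliers *)

Lemma l2norm_le {R : realType} {X Y : normedModType R} (p : X * Y) :
  l2norm p <= `|p.1| + `|p.2|.
Proof.
rewrite /l2norm -[leRHS]ger0_norm ?addr_ge0 // -sqrtr_sqr ler_wsqrtr //.
rewrite sqrrD -addrA [leRHS]addrCA [leRHS]addrC -[leLHS]addr0 -addrA.
by rewrite addrA lerD2l mulrn_wge0 // mulr_ge0.
Qed.

Lemma l2norm_fst {R : realType} {X Y : normedModType R} (p : X * Y) :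
  `|p.1| <= l2norm p.
Proof.
by rewrite /l2norm -[leLHS]ger0_norm // -sqrtr_sqr ler_wsqrtr // lerDl sqr_ge0.
Qed.

Lemma l2norm_snd {R : realType} {X Y : normedModType R} (p : X * Y) :
  `|p.2| <= l2norm p.
Proof.
by rewrite /l2norm -[leLHS]ger0_norm // -sqrtr_sqr ler_wsqrtr // lerDr sqr_ge0.
Qed.

Lemma perturbation_arith1 {R : realType} (C K r m z : R) :
  z <= r -> 0 <= C -> 0 <= K -> 0 <= m -> 0 <= z ->
  r + C * (m + z) <= (C + K + 2) * (r + m).
Proof.
move=> zr C0 K0 m0 z0; have Cz : C * z <= C * r by rewrite ler_wpM2l.
have : 0 <= K * (r + m) by rewrite mulr_ge0 // addr_ge0 // (le_trans z0).
lra.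
Qed.

Lemma perturbation_arith2 {R : realType} (C K r p q d z m : R) :
  p <= q + d -> q <= m -> d <= K * m -> z <= r ->
  0 <= C -> 0 <= K -> 0 <= m -> 0 <= z -> p + z <= (C + K + 2) * (r + m).
Proof.
move=> pq qm dm zr C0 K0 m0 z0; have r0 := le_trans z0 zr.
have : 0 <= C * (r + m) by rewrite mulr_ge0 // addr_ge0.
have : 0 <= K * r by rewrite mulr_ge0.
lra.
Qed.

Section ErrorBound.
Context {R : realType} {X Y : fdHilbertType R}.
Variables (phi : X -> R) (Phi : X -> Y) (g : Y -> \bar R) (Theta : set X)
  (xbar : X) (ybar : Y).
Hypotheses (phiC2 : C2_on setT phi) (PhiC2 : C2_on setT Phi)
  (g_proper : proper_efun g) (g_lsc : lower_semicontinuous g)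
  (g_convex : convex_efun g) (Theta_poly : polyhedral Theta)
  (kkt : kkt_solution phi Phi g Theta xbar ybar).

Let gradL := gradx_L phi Phi.
Let M0 := multiplier_map phi Phi g Theta xbar (0, 0).

Let gybar : subdifferential g (Phi xbar) ybar. Proof. by case: kkt. Qed.

Lemma stationarityP x y v : stationarity phi Phi Theta x y v <->
  normal_cone Theta x (v - gradL x y).
Proof.
split=> [[n nN <-]|nN]; first by rewrite addrC addKr.
by exists (v - gradL x y) => //; rewrite addrC subrK.
Qed.

Lemma multiplier0P y : M0 y -> normal_cone Theta xbar (- gradL xbar y) /\
  subdifferential g (Phi xbar) y.
Proof. by move=> [/stationarityP /=]; rewrite sub0r addr0. Qed.

Let Theta_xbar : Theta xbar. Proof. by case: kkt => [[n []]]. Qed.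

(** [rho] is a strict upper bound of the residual in the application, which provides a normal [n]
    without attainment of the distance; [z] is the proximal displacement. *)
Definition perturbed_kkt x y (rho : R) (n : X) (z : Y) :=
  [/\ normal_cone Theta x n, `|gradL x y + n| <= rho, `|z| <= rho &
      subdifferential g (Phi x - z) (y + z)].

Lemma residual_lt_perturbed x y (rho : R) :
  (residual phi Phi g Theta x y < rho%:E)%E -> exists n z, perturbed_kkt x y rho n z.
Proof.
rewrite /residual; set z := Phi x - _.
have z0 := normr_ge0 z.
rewrite -lteBrDr // -EFinB => /ereal_inf_lt[_ [n nN <-]]; rewrite lte_fin => H.
exists n, z; split=> //.
- by have := normr_ge0 (- gradL x y - n); rewrite -opprD normrN in H *; lra.
- by have := normr_ge0 (- gradx_L phi Phi x y - n); lra.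
have -> : Phi x - z = prox g (Phi x + y) by rewrite /z opprB addrC subrK.
have -> : y + z = Phi x + y - prox g (Phi x + y) by rewrite /z addrA (addrC y).
exact: prox_subdifferential gybar _.
Qed.

(** The vector [y + z] is a multiplier at [xbar] for data [(v, w)] of size [O(rho + |x - xbar|)];
    calmness then provides the nearby exact multiplier. *)
Lemma calm_multiplier : calm l2norm (multiplier_map phi Phi g Theta xbar) (0, 0) ybar ->
  exists gam kap : R, [/\ 0 < gam, 0 < kap & forall x y rho n z,
    `|x - xbar| < gam -> `|y - ybar| < gam -> rho < gam ->
    perturbed_kkt x y rho n z ->
    exists2 yh, M0 yh & `|y + z - yh| <= kap * (rho + `|x - xbar|)].
Proof.
move=> [_ [A [B [k [A0 By k0 calmP]]]]].
have [d1 [C [d10 C0 PC]]] := gradx_L_lipschitz phiC2 PhiC2 xbar ybar.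
have [d2 d20 P2] : exists2 d : R, 0 < d & forall h, `|h| < d ->
    normal_cone Theta (xbar + h) `<=` normal_cone Theta xbar.
  exact: (near_add_ball (polyhedral_normal_cone_sub Theta_poly Theta_xbar)).
have [d3 d30 P3] := differentiable_near (PhiC2.1 xbar I) ltr01.
have [K K0 KP] := linear_bound ('d Phi xbar).
have [d4 d40 P4] : exists2 d : R, 0 < d & forall v w, `|v| < d -> `|w| < d -> A (v, w).
  have [[A1 A2] /= [/nbhs_norm0P[e1 e10 E1] /nbhs_norm0P[e2 e20 E2]] AA] := A0.
  exists (Num.min e1 e2) => [|v w]; first by rewrite lt_min e10.
  rewrite !lt_min => /andP[v1 _] /andP[_ w2].
  by apply: AA; split; [exact: E1|exact: E2].
have [d5 d50 P5] := near_add_ball By.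
pose L := C + K + 2; have L0 : 0 < L by rewrite /L; lra.
(* The bound by [d4 / (2 L)] puts [(v, w)] in the neighborhood [A], that by [d5 / 2] puts [y + z] in
   [B]. *)
pose gam := Num.min (Num.min d1 d2) (Num.min d3 (Num.min (d4 / (2 * L)) (d5 / 2))).
exists gam, (k * (2 * L)); split.
- by rewrite !lt_min d10 d20 d30 !divr_gt0 ?mulr_gt0.
- by rewrite !mulr_gt0.
have [g1 g2 g3 g4 g5] : [/\ gam <= d1, gam <= d2, gam <= d3, gam <= d4 / (2 * L) &
    gam <= d5 / 2] by split; rewrite /gam !ge_min lexx ?orbT.
move=> x y rho n z xg yg rg [nN rn rz sub].
have xE : x = xbar + (x - xbar) by rewrite addrC subrK.
have r0 : 0 <= rho by exact: le_trans rz.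
have {}nN : normal_cone Theta xbar n.
  by apply: (P2 (x - xbar)); [exact: lt_le_trans g2|rewrite -xE].
set yt := y + z.
have Byt : B yt.
  have -> : yt = ybar + (yt - ybar) by rewrite addrC subrK.
  apply: P5; rewrite /yt addrAC; apply: le_lt_trans (ler_normD _ _) _; lra.
have e1 : `|gradL x y - gradL xbar yt| <= C * (`|x - xbar| + `|z|).
  have -> : z = - (y - yt) by rewrite opprB /yt (addrC y) addrK.
  by rewrite normrN; exact: PC (lt_le_trans xg g1) (lt_le_trans yg g1).
set v := gradL xbar yt + n; set w := Phi x - z - Phi xbar.
have vL : `|v| <= L * (rho + `|x - xbar|).
  have -> : v = (gradL x y + n) - (gradL x y - gradL xbar yt).
    by move: (gradL x y) => G; rewrite opprB addrCA addrAC subrr add0r.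
  apply: le_trans (ler_normB _ _) _; apply: le_trans (lerD rn e1) _.
  by apply: perturbation_arith1 rz _ _ _ _; rewrite ?(ltW C0) ?(ltW K0).
have wL : `|w| <= L * (rho + `|x - xbar|).
  have := P3 (x - xbar) (lt_le_trans xg g3); rewrite -xE mul1r.
  set q := Phi x - Phi xbar - _ => qx.
  have -> : w = q + 'd Phi xbar (x - xbar) - z.
    by rewrite /q subrK /w addrAC.
  apply: le_trans (ler_normB _ _) _.
  have := ler_normD q ('d Phi xbar (x - xbar)); have := KP (x - xbar).
  by move=> dx qd; apply: perturbation_arith2 qd qx dx rz _ _ _ _;
    rewrite ?(ltW C0) ?(ltW K0).
have Ld4 : L * (rho + `|x - xbar|) < d4.
  move: g4; rewrite ler_pdivlMr ?mulr_gt0 // => g4.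
  apply: lt_le_trans (_ : L * (gam + gam) <= _).
    by rewrite ltr_pM2l // ltrD.
  by rewrite (_ : L * (gam + gam) = gam * (2 * L)) //; ring.
have Mvw : multiplier_map phi Phi g Theta xbar (v, w) yt.
  split; first by apply/stationarityP; rewrite /= /v addrC addKr.
  by rewrite /= /w addrC subrK.
have [|yh yhM [b b1 ytE]] := calmP (v, w) _ yt (conj Mvw Byt).
  by apply: P4; [exact: le_lt_trans vL Ld4|exact: le_lt_trans wL Ld4].
exists yh => //; rewrite -ytE addrAC subrr add0r normrZ.
rewrite ger0_norm; last by rewrite mulr_ge0 ?(ltW k0) // sqrtr_ge0.
have h : l2norm (((0, 0) : X * Y) - (v, w)) <= `|v| + `|w|.
  by apply: le_trans (l2norm_le _) _; rewrite /= !sub0r !normrN.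
apply: le_trans (_ : k * l2norm ((0, 0) - (v, w)) * 1 <= _).
  by apply: ler_wpM2l => //; rewrite mulr_ge0 ?(ltW k0) // sqrtr_ge0.
rewrite mulr1 -!mulrA ler_pM2l //; apply: le_trans h _.
by rewrite mulr2n mulrDl mul1r; exact: lerD.
Qed.

(** * Contradiction with the second-order sufficient condition *)

Section Contradiction.
Hypotheses (sosc : SOSC phi Phi g Theta xbar ybar)
  (second_order : forall w eta,
     semistrict_derivative (subdifferential g) (Phi xbar) ybar w eta ->
     (second_subderivative g (Phi xbar) ybar w <= (inner eta w)%:E)%E).

(** The limit form of the argument: [z k] and the stationarity errors are [o(t k)], while
    [x k - xbar] and [y k + z k - yh k] have limits at scale [t k]. *)
Lemma no_slow_perturbation (t : nat -> R) (x n : nat -> X) (y z yh : nat -> Y)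
    (w : X) (eta : Y) :
  to_zero_pos t -> w <> 0 -> y @ \oo --> ybar ->
  (fun k => (t k)^-1 *: (x k - xbar)) @ \oo --> w ->
  (fun k => (t k)^-1 *: z k) @ \oo --> (0 : Y) ->
  (fun k => (t k)^-1 *: (gradL (x k) (y k) + n k)) @ \oo --> (0 : X) ->
  (fun k => (t k)^-1 *: (y k + z k - yh k)) @ \oo --> eta ->
  (forall k, normal_cone Theta (x k) (n k)) ->
  (forall k, subdifferential g (Phi (x k) - z k) (y k + z k)) ->
  (forall k, M0 (yh k)) -> False.
Proof.
move=> tz w0 yy xw z0 q0 ye nN sub yhM.
have t0 k : 0 < t k by case: tz.
have tn0 k : t k != 0 by rewrite gt_eqF.
have unscale (V : normedModType R) (v : nat -> V) (l : V) :
    (fun k => (t k)^-1 *: v k) @ \oo --> l -> v @ \oo --> (0 : V).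
  move=> vl; have -> : v = (fun k => t k *: ((t k)^-1 *: v k)).
    by apply/funext => k; rewrite scalerA mulfV ?scale1r.
  by rewrite -(scale0r l); apply: cvgZ => //; case: tz.
have [a aE] : exists a : nat -> X, a = (fun k => (t k)^-1 *: (x k - xbar)) by eexists.
rewrite -aE in xw.
have xE k : x k = xbar + t k *: a k.
  by rewrite aE scalerA mulfV ?scale1r // addrC subrK.
have xx : (fun k => x k - xbar) @ \oo --> (0 : X).
  by apply: (unscale _ _ w); rewrite -aE.
have zz := unscale _ _ _ z0.
have yzy : (fun k => y k + z k) @ \oo --> ybar.
  by rewrite -[X in _ --> X]addr0; apply: cvgD.
have yhy : yh @ \oo --> ybar.
  have -> : yh = (fun k => (y k + z k) - (y k + z k - yh k)).
    by apply/funext => k; rewrite subKr.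
  by rewrite -[X in _ --> X]subr0; apply: cvgB => //; exact: (unscale _ _ _ ye).
pose b k := (t k)^-1 *: (Phi (x k) - z k - Phi xbar).
have dPhi : (fun k => (t k)^-1 *: (Phi (x k) - Phi xbar)) @ \oo --> 'd Phi xbar w.
  have -> : (fun k => (t k)^-1 *: (Phi (x k) - Phi xbar)) =
     (fun k => (t k)^-1 *: (Phi (xbar + t k *: a k) - Phi xbar)).
    by apply/funext => k; rewrite -xE.
  exact: differentiable_seq (PhiC2.1 xbar I) tz xw.
have bw : b @ \oo --> 'd Phi xbar w.
  rewrite -[X in _ --> X]subr0.
  have -> : b = (fun k => (t k)^-1 *: (Phi (x k) - Phi xbar))
      - (fun k => (t k)^-1 *: z k).
    by apply/funext => k; rewrite /b !fctE -scalerBr addrAC.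
  exact: cvgB.
have bE k : Phi (x k) - z k = Phi xbar + t k *: b k.
  by rewrite /b scalerA mulfV ?scale1r // [RHS]addrC subrK.
have sd : semistrict_derivative (subdifferential g) (Phi xbar) ybar ('d Phi xbar w) eta.
  exists t, (fun k => Phi (x k) - z k), (fun k => y k + z k), yh; split=> //.
    split=> //; rewrite -[X in _ --> X](subr0 (Phi xbar)); apply: cvgB => //.
    have := unscale _ _ _ dPhi.
    have -> : (fun k => Phi (x k)) = (fun k => (Phi (x k) - Phi xbar) + Phi xbar).
      by apply/funext => k; rewrite subrK.
    move=> h; rewrite -[X in _ --> X]add0r; apply: cvgD => //; exact: cvg_cst.
  by move=> k; split; [exact: sub|have [] := multiplier0P (yhM k)].
have [d [C [d0 C0 lipP]]] := gradx_L_lipschitz phiC2 PhiC2 xbar ybar.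
have gradc : (fun k => gradL (x k) (y k)) @ \oo --> gradL xbar ybar.
  apply/cvgrPdistC_le => e e0.
  have dx : \forall k \near \oo, `|x k - xbar| < d by exact: cvgr0_norm_lt.
  have dy : \forall k \near \oo, `|y k - ybar| < d.
    by move/cvgrPdistC_lt: yy; apply.
  have ex : \forall k \near \oo, C * (`|x k - xbar| + `|y k - ybar|) <= e.
    apply: (cvgr_le 0) => //.
    have -> : 0 = C * (`|0 : X| + `|ybar - ybar|) by rewrite subrr !normr0 addr0 mulr0.
    apply: cvgM; first exact: cvg_cst.
    apply: cvgD; apply: cvg_norm => //; apply: cvgB => //; exact: cvg_cst.
  near=> k; apply: le_trans (lipP _ _ _ _ _) _; by near: k.
have nn : n @ \oo --> - gradL xbar ybar.
  have -> : n = (fun k => (gradL (x k) (y k) + n k) - gradL (x k) (y k)).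
    by apply/funext => k; rewrite addrC addKr.
  by rewrite -[X in _ --> X]add0r; apply: cvgB => //; exact: (unscale _ _ _ q0).
have wT : critical_cone (indicator Theta) xbar (- gradL xbar ybar) w.
  apply: (subgradient_critical _ tz xw nn).
    apply: indicator_subdifferential.
    by have [/stationarityP + _] := kkt; rewrite sub0r.
  by move=> k; rewrite -xE; exact: indicator_subdifferential.
have wg : critical_cone g (Phi xbar) ybar ('d Phi xbar w).
  by apply: (subgradient_critical gybar tz bw yzy) => k; rewrite -bE.
have := sosc (conj wT wg) w0; rewrite ltNge => /negP; apply.
apply: le_trans (leeD2l _ (second_order sd)) _.
rewrite -EFinD lee_fin.
have [d2 [K2 [d20 K20 P2]]] := C2_lipschitz (fun e => (PhiC2.2 e).1 xbar I).
have hess : (fun k => (t k)^-1 *: (gradL (x k) ybar - gradL xbar ybar)) @ \oo -->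
    hessx_L phi Phi xbar ybar w.
  have -> : (fun k => (t k)^-1 *: (gradL (x k) ybar - gradL xbar ybar)) =
     (fun k => (t k)^-1 *: (gradient (lagrangian phi Phi ^~ ybar) (xbar + t k *: a k)
       - gradient (lagrangian phi Phi ^~ ybar) xbar)).
    by apply/funext => k; rewrite -xE.
  exact: differentiable_seq (differentiable_gradx_L phiC2 PhiC2 xbar ybar) tz xw.
(* Mixed term: [y k - ybar] tends to [0] and the difference quotient of ['d Phi] is bounded. *)
pose r k := inner (y k - ybar) ((t k)^-1 *: ('d Phi (x k) (a k) - 'd Phi xbar (a k))).
have r0 : r @ \oo --> 0.
  apply/cvgr0Pnorm_le => e e0.
  pose Q := K2 * (`|w| + 1) * (`|w| + 1).
  have Q0 : 0 < Q + 1 by rewrite ltr_wpDl // /Q !mulr_ge0 ?addr_ge0 // ltW.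
  have dx : \forall k \near \oo, `|x k - xbar| < d2 by exact: cvgr0_norm_lt.
  have dy : \forall k \near \oo, `|y k - ybar| < e / (Q + 1).
    by move/cvgrPdistC_lt: yy; apply; rewrite divr_gt0.
  have aw : \forall k \near \oo, `|a k| <= `|w| + 1.
    by apply: (@cvgr_le _ _ _ _ _ `|w|); [exact: cvg_norm|rewrite ltrDl].
  near=> k; apply: le_trans (cauchy_schwarz _ _) _.
  have -> : e = e / (Q + 1) * (Q + 1) by rewrite divfK // gt_eqF.
  apply: ler_pM => //; first by apply: ltW; near: k.
  rewrite normrZ gtr0_norm ?invr_gt0 // mulrC ler_pdivrMr //.
  have k1 : `|x k - xbar| < d2 by near: k.
  have k2 : `|a k| <= `|w| + 1 by near: k.
  have := P2 (x k - xbar) (a k) k1; rewrite (addrC xbar) subrK => h.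
  apply: le_trans h _.
  have -> : `|x k - xbar| = t k * `|a k|.
    by rewrite xE addrC addKr normrZ gtr0_norm.
  have : K2 * `|a k| * `|a k| <= Q.
    by rewrite /Q -!mulrA ler_pM2l // ler_pM.
  move=> h; have := t0 k; nra.
(* Monotonicity for the normals [n k] at [x k] and [- gradL xbar (yh k)] at [xbar], divided by
   [t k ^+ 2]. *)
have mono : \forall k \near \oo,
    inner ((t k)^-1 *: (gradL (x k) ybar - gradL xbar ybar)) (a k) + r k
    + inner ((t k)^-1 *: (y k + z k - yh k) - (t k)^-1 *: z k) ('d Phi xbar (a k))
    - inner ((t k)^-1 *: (gradL (x k) (y k) + n k)) (a k) <= 0.
  apply: nearW => k.
  have := normal_cone_monotone (nN k) (multiplier0P (yhM k)).1.
  have -> : x k - xbar = t k *: a k by rewrite xE addrC addKr.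
  rewrite innerZr pmulr_rge0 // opprK => h.
  rewrite -scalerBr /r innerZr !innerZl -!mulrDr -mulrBr pmulr_rle0 ?invr_gt0 //.
  have -> : y k + z k - yh k - z k = y k - yh k by rewrite addrAC addrK.
  exact: inner_gradient_monotone (gradx_LE phiC2 PhiC2 (x k) ybar (a k))
    (gradx_LE phiC2 PhiC2 xbar ybar (a k)) (gradx_LE phiC2 PhiC2 (x k) (y k) (a k))
    (gradx_LE phiC2 PhiC2 xbar (yh k) (a k)) h.
have L : (fun k => inner ((t k)^-1 *: (gradL (x k) ybar - gradL xbar ybar)) (a k) + r k
    + inner ((t k)^-1 *: (y k + z k - yh k) - (t k)^-1 *: z k) ('d Phi xbar (a k))
    - inner ((t k)^-1 *: (gradL (x k) (y k) + n k)) (a k)) @ \oo -->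
    inner (hessx_L phi Phi xbar ybar w) w + 0 + inner (eta - 0) ('d Phi xbar w)
    - inner 0 w.
  have daw : (fun k => 'd Phi xbar (a k)) @ \oo --> 'd Phi xbar w.
    by apply: continuous_cvg xw; exact: linear_continuous_fd.
  apply: cvgB; last exact: cvg_inner.
  apply: cvgD; last by apply: cvg_inner => //; exact: cvgB.
  by apply: cvgD => //; exact: cvg_inner.
have := cvgr_to_le L mono; rewrite inner0l addr0 !subr0; exact.
Unshelve. all: by end_near. Qed.

Lemma cvg0_inv_succ (V : normedModType R) (v : nat -> V) :
  (forall k, `|v k| <= k.+1%:R^-1) -> v @ \oo --> (0 : V).
Proof.
move=> vk; apply/cvgr0Pnorm_le => e e0.
have := near_infty_natSinv_lt (PosNum e0); apply: filterS => k /= ke.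
exact: le_trans (vk k) (ltW ke).
Qed.

Lemma primal_error_bound :
  calm l2norm (multiplier_map phi Phi g Theta xbar) (0, 0) ybar ->
  exists gam kap : R, [/\ 0 < gam, 0 < kap & forall x y rho n z,
    `|x - xbar| < gam -> `|y - ybar| < gam ->
    perturbed_kkt x y rho n z -> `|x - xbar| <= kap * rho].
Proof.
move=> /calm_multiplier[gam [kap [gam0 kap0 calmP]]]; apply: contrapT => nE.
have /choice[p pP] : forall k, exists p : X * Y * R * X * Y * Y,
    let: (x, y, rho, n, z, yh) := p in
    [/\ perturbed_kkt x y rho n z, `|x - xbar| < k.+1%:R^-1,
        `|y - ybar| < k.+1%:R^-1 & k.+1%:R * rho < `|x - xbar|] /\
    (M0 yh /\ `|y + z - yh| <= kap * (rho + `|x - xbar|)).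
  move=> k; apply: contrapT => nk; apply: nE.
  have k0 : (0 : R) < k.+1%:R by [].
  (* Failure with this radius and constant makes [rho] negligible against [|x - xbar|] and keeps it
     below [gam], as [calmP] requires. *)
  exists (Num.min gam k.+1%:R^-1), k.+1%:R; split=> //.
    by rewrite lt_min gam0 invr_gt0.
  move=> x y rho n z; rewrite !lt_min => /andP[x1 x2] /andP[y1 y2] pk.
  rewrite leNgt; apply/negP => kx; apply: nk.
  have r0 : 0 <= rho by case: pk => _ _ + _; exact: le_trans.
  have rx : rho < gam.
    apply: le_lt_trans x1; apply: le_trans (ltW kx).
    by rewrite ler_peMl // ler1n.
  by have [yh yhM yhb] := calmP x y rho n z x1 y1 rx pk; exists (x, y, rho, n, z, yh).
pose x k := (p k).1.1.1.1.1; pose y k := (p k).1.1.1.1.2.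
pose rho k := (p k).1.1.1.2; pose n k := (p k).1.1.2.
pose z k := (p k).1.2; pose yh k := (p k).2; pose t k := `|x k - xbar|.
have {}pP k : [/\ perturbed_kkt (x k) (y k) (rho k) (n k) (z k), t k < k.+1%:R^-1,
        `|y k - ybar| < k.+1%:R^-1 & k.+1%:R * rho k < t k] /\
    (M0 (yh k) /\ `|y k + z k - yh k| <= kap * (rho k + t k)).
  have := pP k; rewrite /t /x /y /rho /n /z /yh.
  by case: (p k) => [[[[[]]]]].
have r0 k : 0 <= rho k.
  by have [[[_ _ zr _] _ _ _] _] := pP k; exact: le_trans zr.
have t0 k : 0 < t k.
  have [[_ _ _ rt] _] := pP k; apply: le_lt_trans rt.
  by rewrite mulr_ge0.
have rt k : rho k / t k <= k.+1%:R^-1.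
  have [[_ _ _ h] _] := pP k.
  by rewrite ler_pdivrMr // mulrC ler_pdivlMr // mulrC ltW.
have scale_le (V : normedModType R) (v : nat -> V) k : `|v k| <= rho k ->
    `|(t k)^-1 *: v k| <= k.+1%:R^-1.
  move=> vr; rewrite normrZ gtr0_norm ?invr_gt0 // mulrC.
  by apply: le_trans (rt k); rewrite ler_pM2r ?invr_gt0.
pose a k := (t k)^-1 *: (x k - xbar).
have a1 k : `|a k| = 1.
  by rewrite normrZ gtr0_norm ?invr_gt0 // mulVf // gt_eqF.
pose e k := (t k)^-1 *: (y k + z k - yh k).
(* Uses [rho k <= t k], which holds because the failing constant [k + 1] is at least [1]. *)
have eb k : `|e k| <= kap * 2.
  rewrite normrZ gtr0_norm ?invr_gt0 // mulrC ler_pdivrMr //.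
  have [_ [_ h]] := pP k; apply: le_trans h _; rewrite -mulrA ler_pM2l //.
  have := rt k; rewrite ler_pdivrMr // => h.
  rewrite mulr_natl mulr2n lerD2r; apply: le_trans h _.
  by rewrite ler_piMl ?(ltW (t0 k)) // invf_le1 // ler1n.
have ak k : `|a k| <= 1 by rewrite a1.
have [s1 [w [s1k aw]]] := bounded_cvg_subseq ak.
have [s2 [eta [s2k ew]]] := bounded_cvg_subseq (fun k => eb (s1 k)).
pose s k := s1 (s2 k).
have sk k : (k <= s k)%N by exact: leq_trans (s2k k) (s1k _).
have {}aw := cvg_subseq s2k aw.
have w0 : w <> 0.
  move=> w0; have : 1 <= `|w|.
    apply: (cvgr_to_ge (cvg_norm aw)); apply: nearW => k /=.
    by rewrite a1.
  by rewrite w0 normr0 ler10.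
apply: (@no_slow_perturbation (t \o s) (x \o s) (n \o s) (y \o s) (z \o s) (yh \o s)
  w eta) => //.
- split=> [k|]; first exact: t0.
  apply: (cvg_subseq sk); apply: cvg0_inv_succ => k.
  have [[_ h _ _] _] := pP k.
  by rewrite gtr0_norm // ltW.
- apply: (cvg_subseq sk); rewrite -[X in _ --> X]add0r.
  have -> : y = (fun k => (y k - ybar) + ybar) by apply/funext => k; rewrite subrK.
  apply: cvgD; last exact: cvg_cst.
  by apply: cvg0_inv_succ => k; have [[_ _ h _] _] := pP k; exact: ltW.
- apply: (@cvg_subseq _ (fun k => (t k)^-1 *: z k) 0 s sk).
  apply: cvg0_inv_succ => k; apply: scale_le.
  by have [[[]]] := pP k.
- apply: (@cvg_subseq _ (fun k => (t k)^-1 *: (gradL (x k) (y k) + n k)) 0 s sk).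
  apply: cvg0_inv_succ => k; apply: (scale_le _ (fun k => gradL (x k) (y k) + n k)).
  by have [[[]]] := pP k.
- by move=> k; have [[[]]] := pP (s k).
- by move=> k; have [[[]]] := pP (s k).
- by move=> k; have [_ []] := pP (s k).
Qed.

(** The primal bound is inserted into the multiplier estimate of [calm_multiplier]. *)
Lemma perturbed_error_bound :
  calm l2norm (multiplier_map phi Phi g Theta xbar) (0, 0) ybar ->
  exists gam kap : R, [/\ 0 < gam, 0 < kap & forall x y rho,
    `|x - xbar| < gam -> `|y - ybar| < gam ->
    (residual phi Phi g Theta x y < rho%:E)%E ->
    ((`|x - xbar|)%:E + dist y M0 <= (kap * rho)%:E)%E].
Proof.
move=> C; have [gA [kA [gA0 kA0 PA]]] := primal_error_bound C.
have [gB [kB [gB0 kB0 PB]]] := calm_multiplier C.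
have M0bar : M0 ybar.
  split; last by rewrite /= addr0.
  by case: kkt.
have kAB : 0 < kB * (1 + kA) by rewrite mulr_gt0 // addr_gt0.
(* The last [1] pays for [z] in [y - yh = (y + z - yh) - z], and for the case of large [rho]. *)
exists (Num.min gA gB), (kA + kB * (1 + kA) + 1); split.
- by rewrite lt_min gA0.
- lra.
move=> x y rho; rewrite !lt_min => /andP[xA xB] /andP[yA yB].
move=> /residual_lt_perturbed[n [z pk]].
have xr := PA _ _ _ _ _ xA yA pk.
have r0 : 0 <= rho by case: pk => _ _ + _; exact: le_trans.
have kr : 0 <= kB * (1 + kA) * rho by rewrite mulr_ge0 // ltW.
rewrite mulrDl mulrDl mul1r -addrA EFinD; apply: leeD; first by rewrite lee_fin.
(* For [rho >= gB] the multiplier [ybar] itself suffices, since [|y - ybar| < gB]. *)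
have [rB|rB] := ltP rho gB; last first.
  apply: le_trans (_ : (`|y - ybar|)%:E <= _)%E; last by rewrite lee_fin; lra.
  by apply: ereal_inf_lbound; exists ybar.
have [yh yhM yhb] := PB _ _ _ _ _ xB yB rB pk.
apply: le_trans (_ : (`|y - yh|)%:E <= _)%E.
  by apply: ereal_inf_lbound; exists yh.
rewrite lee_fin; have -> : y - yh = (y + z - yh) - z by rewrite addrAC addrK.
apply: le_trans (ler_normB _ _) _; apply: lerD; last by case: pk.
by apply: le_trans yhb _; rewrite -mulrA ler_pM2l // mulrDl mul1r lerD2l.
Qed.

End Contradiction.
End ErrorBound.

(** * The error bound in terms of the residual *)

Theorem theorem3p9 (R : realType) (X Y : fdHilbertType R)
    (phi : X -> R) (Phi : X -> Y) (g : Y -> \bar R) (Theta : set X)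
    (xbar : X) (ybar : Y)
    (phiC2 : C2_on setT phi) (PhiC2 : C2_on setT Phi)
    (g_proper : proper_efun g) (g_lsc : lower_semicontinuous g)
    (g_convex : convex_efun g)
    (Theta_poly : polyhedral Theta)
    (kkt : kkt_solution phi Phi g Theta xbar ybar)
    (sosc : SOSC phi Phi g Theta xbar ybar)
    (cond_ab :
       (exists (Z : fdHilbertType R) (O : set Y) (theta : Z -> \bar R)
               (Xi : Y -> Z),
          C2_decomposition g (Phi xbar) O theta Xi /\
          nondegeneracy (Phi xbar) theta Xi)
       \/
       (twice_epi_differentiable g (Phi xbar) ybar /\
        forall w : Y,
          semistrict_derivative (subdifferential g) (Phi xbar) ybar w
          = closure
              [set d - k
                 | d in graphical_derivative (subdifferential g)
                          (Phi xbar) ybar w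
                 & k in polar_cone (critical_cone g (Phi xbar) ybar)]))
    (M_calm : calm l2norm (multiplier_map phi Phi g Theta xbar) (0, 0) ybar) :
  exists gamma kappa : R, [/\ 0 < gamma, 0 <= kappa &
    forall (x : X) (y : Y), closed_ball_ l2norm (xbar, ybar) gamma (x, y) ->
      ((`|x - xbar|)%:E + dist y (multiplier_map phi Phi g Theta xbar (0%R, 0%R))
       <= kappa%:E * residual phi Phi g Theta x y)%E].
Proof.
have gy : subdifferential g (Phi xbar) ybar by case: kkt.
have second_order w eta :
    semistrict_derivative (subdifferential g) (Phi xbar) ybar w eta ->
    (second_subderivative g (Phi xbar) ybar w <= (inner eta w)%:E)%E.
  case: cond_ab => [[Z [U [theta [Xi [dec nd]]]]]|[epi E]].
    exact: semistrict_second_order_decomposable dec nd gy.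
  exact: semistrict_second_order_epi gy epi (E w).
have [gam [kap [gam0 kap0 P]]] := perturbed_error_bound phiC2 PhiC2 g_proper
  g_lsc g_convex Theta_poly kkt sosc second_order M_calm.
(* Halving turns the closed ball into the strict inequalities required by [P]. *)
exists (gam / 2), kap; split; [by rewrite divr_gt0|exact: ltW|].
move=> x y xy.
have gam2 : gam / 2 < gam by lra.
have xg : `|x - xbar| < gam.
  by apply: le_lt_trans gam2; apply: le_trans xy; rewrite distrC;
    exact: (l2norm_fst ((xbar, ybar) - (x, y))).
have yg : `|y - ybar| < gam.
  by apply: le_lt_trans gam2; apply: le_trans xy; rewrite distrC;
    exact: (l2norm_snd ((xbar, ybar) - (x, y))).
have res0 : (0 <= residual phi Phi g Theta x y)%E.
  apply: adde_ge0; last by rewrite lee_fin.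
  by apply: le_ereal_inf_tmp => _ [n _ <-]; rewrite lee_fin.
(* An infinite residual makes the right side [+oo], because [kap > 0]. *)
case rE : (residual phi Phi g Theta x y) res0 => [r| |] // _; last first.
  by rewrite mulry gtr0_sg // mul1e leey.
apply/lee_addgt0Pr => e e0.
(* [P] needs a strict bound on the residual: [r + e / kap] is one and costs only [e]. *)
rewrite -EFinM -EFinD (_ : kap * r + e = kap * (r + e / kap)).
  by apply: P => //; rewrite rE lte_fin ltrDl divr_gt0.
by field; rewrite gt_eqF.
Qed.
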